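(* Let $m\ge2$ be an integer and let $P_m$ be the unit polydisc in $\mathbb C^m$ endowed with the metric $F_{t,k}$. Then for any fixed $t\in[0,+\infty)$ and any fixed integer $k\ge2$, $(P_m,F_{t,k})$ is a Kähler Finsler-Einstein manifold with factor $\varphi=-2$.
   Context: $P_m=\{z=(z^1,\dots,z^m)\in\mathbb C^m:|z^l|<1\}$, with $T_z^{1,0}P_m\cong\mathbb C^m$, and $$F_{t,k}(z;v)=\frac{1}{\sqrt{1+t}}\sqrt{\sum_{l=1}^m\frac{|v^l|^2}{(1-|z^l|^2)^2}+t\sqrt[k]{\sum_{l=1}^m\frac{|v^l|^{2k}}{(1-|z^l|^2)^{2k}}}},\quad z\in P_m,\ v\in \mathbb C^m.$$ Complex Finsler metrics. A complex Finsler metric on a domain $D\subset\mathbb C^m$ is a continuous function $F:T^{1,0}D\to[0,+\infty)$ with $G=F^2$ being $C^\infty$ off the zero section, $F(z;v)=0$ iff $v=0$, and $F(z;\lambda v)=|\lambda|F(z;v)$ for $\lambda\in\mathbb C$. It is strongly pseudoconvex if the matrix $(G_{i\overline j})$, $G_{i\overline j}=\partial^2G/\partial v^i\partial\overline{v^j}$, is positive definite off the zero section; $(G^{\overline s i})$ denotes the inverse matrix of $(G_{i\overline s})$. The Chern-Finsler nonlinear connection coefficients are $\Gamma^i_{;l}=G^{\overline s i}\,\partial^2G/\partial\overline{v^s}\partial z^l$ (sum over $s$), and the horizontal Chern-Finsler connection coefficients are $\Gamma^i_{j;l}=\partial\Gamma^i_{;l}/\partial v^j$. $F$ is Kähler-Finsler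 if $\Gamma^i_{j;l}=\Gamma^i_{l;j}$, complex Berwald if the $\Gamma^i_{j;l}$ do not depend on $v$, and Kähler-Berwald if it is both. It is known that $F_{t,k}$ is a (strongly convex, $\mathrm{Aut}(P_m)$-invariant) Kähler-Berwald metric on $P_m$. Einstein condition. For a complex Berwald metric, the curvature components of the partial connection (equivalently, of the horizontal Chern-Finsler connection) are $R^i_{j\alpha\overline\beta}=-\partial\Gamma^i_{j;\alpha}/\partial\overline{z^\beta}$. For a complex Berwald manifold there is a Hermitian metric on the base whose Hermitian (Chern) connection pulls back to the partial connection of $F$, and one takes such a metric $g=g_{\alpha\overline\beta}dz^\alpha d\overline z^\beta$ to define the partial mean curvature $K^i_j=g^{\overline\beta\alpha}R^i_{j\alpha\overline\beta}$. For $(P_m,F_{t,k})$ this metric is taken to be the Bergman metric $g=\sum_{l=1}^m\frac{dz^l\,d\overline z^l}{(1-|z^l|^2)^2}$, i.e. $g_{\alpha\overline\beta}=\delta_{\alpha\beta}(1-|z^\alpha|^2)^{-2}$. A Kähler-Berwald manifold is called a Kähler Finsler-Einstein manifold with factor $\varphi$ if $K^i_j=\varphi\,\delta^i_j$ with $\varphi$ a constant. *)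

(* Defs.v *)
From HB Require Import structures.
From mathcomp Require Import all_boot all_order all_algebra.
From mathcomp Require Import complex.
From mathcomp Require Import all_classical all_reals all_analysis.

Set Implicit Arguments.
Unset Strict Implicit.
Unset Printing Implicit Defensive.

Import Order.TTheory GRing.Theory Num.Theory.
Import numFieldNormedType.Exports.

Local Open Scope classical_set_scope.
Local Open Scope complex_scope.
Local Open Scope ring_scope.

(* C^m is 'rV[R[i]]_m. Its topology and its C^oo structure are those of
   R^m * R^m, transported along [ofreal] : (x, y) |-> x + iy. *)
Definition ofreal (R : realType) (m : nat) (p : 'rV[R]_m * 'rV[R]_m) :
    'rV[R[i]]_m :=
  \row_j (p.1 0 j +i* p.2 0 j)%C.

Definition ofreal2 (R : realType) (m : nat)
    (p : ('rV[R]_m * 'rV[R]_m) * ('rV[R]_m * 'rV[R]_m)) :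
    'rV[R[i]]_m * 'rV[R[i]]_m :=
  (ofreal p.1, ofreal p.2).

(* Class C^n on an open subset U of a finite-dimensional V: all iterated
   directional derivatives up to order n exist and are continuous on U. *)
Fixpoint Cn (R : realType) (V : normedModType R) (n : nat) (U : set V)
    (f : V -> R) : Prop :=
  (forall x, U x -> {for x, continuous f}) /\
  match n with
  | 0 => True
  | n'.+1 => forall v : V,
      (forall x, U x -> derivable f x v) /\ Cn n' U (fun x => 'D_v f x)
  end.

Definition smooth (R : realType) (V : normedModType R) (U : set V)
    (f : V -> R) : Prop :=
  forall n, Cn n U f.

Definition smooth_base (R : realType) (m : nat) (D : set 'rV[R[i]]_m)
    (f : 'rV[R[i]]_m -> R[i]) : Prop :=
  smooth (@ofreal R m @^-1` D) (fun p => complex.Re (f (ofreal p))) /\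
  smooth (@ofreal R m @^-1` D) (fun p => complex.Im (f (ofreal p))).

Definition is_domain (R : realType) (m : nat) (D : set 'rV[R[i]]_m) : Prop :=
  [/\ D !=set0, open (@ofreal R m @^-1` D) & connected (@ofreal R m @^-1` D)].

(* Wirtinger derivatives d/dz^l = (d/dx^l - i d/dy^l) / 2 and
   d/dzbar^l = (d/dx^l + i d/dy^l) / 2; the real derivative of a complex-valued
   function is taken on its real and imaginary parts. *)
Definition rderive0 (R : realType) (h : R -> R[i]) : R[i] :=
  (derive1 (fun s => complex.Re (h s)) 0 +i*
   derive1 (fun s => complex.Im (h s)) 0)%C.

Definition partial_x (R : realType) (m : nat) (l : 'I_m)
    (f : 'rV[R[i]]_m -> R[i]) (z : 'rV[R[i]]_m) : R[i] :=
  rderive0 (fun s : R => f (z + (s +i* 0)%C *: delta_mx 0 l)).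

Definition partial_y (R : realType) (m : nat) (l : 'I_m)
    (f : 'rV[R[i]]_m -> R[i]) (z : 'rV[R[i]]_m) : R[i] :=
  rderive0 (fun s : R => f (z + (0 +i* s)%C *: delta_mx 0 l)).

Definition dz (R : realType) (m : nat) (l : 'I_m)
    (f : 'rV[R[i]]_m -> R[i]) (z : 'rV[R[i]]_m) : R[i] :=
  2^-1 * (partial_x l f z - 'i%C * partial_y l f z).

Definition dzbar (R : realType) (m : nat) (l : 'I_m)
    (f : 'rV[R[i]]_m -> R[i]) (z : 'rV[R[i]]_m) : R[i] :=
  2^-1 * (partial_x l f z + 'i%C * partial_y l f z).

(* In R[i], 0 < c entails that c is real, so such an A is Hermitian. *)
Definition posdef (R : realType) (m : nat) (A : 'M[R[i]]_m) : Prop :=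
  forall w : 'rV[R[i]]_m, w != 0 ->
    0 < \sum_i \sum_j A i j * w 0 i * (w 0 j)^*%C.

Definition Gsq (R : realType) (m : nat)
    (F : 'rV[R[i]]_m -> 'rV[R[i]]_m -> R) (z v : 'rV[R[i]]_m) : R[i] :=
  (F z v ^+ 2)%:C%C.

Record complex_finsler (R : realType) (m : nat) (D : set 'rV[R[i]]_m)
    (F : 'rV[R[i]]_m -> 'rV[R[i]]_m -> R) : Prop := ComplexFinsler {
  cf_domain : is_domain D;
  cf_continuous : forall p, D (ofreal2 p).1 ->
    {for p, continuous (fun q => F (@ofreal2 R m q).1 (@ofreal2 R m q).2)};
  cf_smooth :
    smooth (@ofreal2 R m @^-1` [set p | D p.1 /\ p.2 != 0])
           (fun q => F (@ofreal2 R m q).1 (@ofreal2 R m q).2 ^+ 2);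
  cf_ge0 : forall z v, D z -> 0 <= F z v;
  cf_eq0 : forall z v, D z -> (F z v = 0 <-> v = 0);
  cf_homogeneous : forall z v (a : R[i]), D z ->
    F z (a *: v) = Normc.normc a * F z v }.

(* The matrix (G_{i jbar}). *)
Definition levi_mx (R : realType) (m : nat)
    (F : 'rV[R[i]]_m -> 'rV[R[i]]_m -> R) (z v : 'rV[R[i]]_m) : 'M[R[i]]_m :=
  \matrix_(i, j) dz i (dzbar j (Gsq F z)) v.

Definition strongly_pseudoconvex (R : realType) (m : nat)
    (D : set 'rV[R[i]]_m) (F : 'rV[R[i]]_m -> 'rV[R[i]]_m -> R) : Prop :=
  forall z v, D z -> v != 0 -> posdef (levi_mx F z v).

(* Gamma^i_{;l}. The entry (s, i) of the inverse of (G_{i sbar}) is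
   G^{sbar i}. *)
Definition nonlinear_coef (R : realType) (m : nat)
    (F : 'rV[R[i]]_m -> 'rV[R[i]]_m -> R) (i l : 'I_m)
    (z v : 'rV[R[i]]_m) : R[i] :=
  \sum_s invmx (levi_mx F z v) s i *
         dzbar s (fun u => dz l (fun x => Gsq F x u) z) v.

(* Gamma^i_{j;l} *)
Definition horizontal_coef (R : realType) (m : nat)
    (F : 'rV[R[i]]_m -> 'rV[R[i]]_m -> R) (i j l : 'I_m)
    (z v : 'rV[R[i]]_m) : R[i] :=
  dz j (nonlinear_coef F i l z) v.

Definition kahler_finsler (R : realType) (m : nat) (D : set 'rV[R[i]]_m)
    (F : 'rV[R[i]]_m -> 'rV[R[i]]_m -> R) : Prop :=
  forall (i j l : 'I_m) z v, D z -> v != 0 ->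
    horizontal_coef F i j l z v = horizontal_coef F i l j z v.

Definition complex_berwald (R : realType) (m : nat) (D : set 'rV[R[i]]_m)
    (F : 'rV[R[i]]_m -> 'rV[R[i]]_m -> R) : Prop :=
  forall (i j l : 'I_m) z v w, D z -> v != 0 -> w != 0 ->
    horizontal_coef F i j l z v = horizontal_coef F i j l z w.

Record kahler_berwald (R : realType) (m : nat) (D : set 'rV[R[i]]_m)
    (F : 'rV[R[i]]_m -> 'rV[R[i]]_m -> R) : Prop := KahlerBerwald {
  kb_finsler : complex_finsler D F;
  kb_pseudoconvex : strongly_pseudoconvex D F;
  kb_kahler : kahler_finsler D F;
  kb_berwald : complex_berwald D F }.

(* R^i_{j alpha betabar}; for a complex Berwald metric its value does not
   depend on v != 0. *)
Definition curvature (R : realType) (m : nat)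
    (F : 'rV[R[i]]_m -> 'rV[R[i]]_m -> R) (i j a b : 'I_m)
    (z v : 'rV[R[i]]_m) : R[i] :=
  - dzbar b (fun x => horizontal_coef F i j a x v) z.

Record hermitian_metric (R : realType) (m : nat) (D : set 'rV[R[i]]_m)
    (g : 'rV[R[i]]_m -> 'M[R[i]]_m) : Prop := HermitianMetric {
  hm_smooth : forall a b, smooth_base D (fun z => g z a b);
  hm_posdef : forall z, D z -> posdef (g z) }.

(* Coefficients g^{sbar i} dg_{j sbar}/dz^l of the Chern connection of g. *)
Definition chern_coef (R : realType) (m : nat)
    (g : 'rV[R[i]]_m -> 'M[R[i]]_m) (i j l : 'I_m) (z : 'rV[R[i]]_m) : R[i] :=
  \sum_s invmx (g z) s i * dz l (fun x => g x j s) z.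

(* The Chern connection of g pulls back to the partial connection of F. *)
Definition chern_compatible (R : realType) (m : nat) (D : set 'rV[R[i]]_m)
    (F : 'rV[R[i]]_m -> 'rV[R[i]]_m -> R)
    (g : 'rV[R[i]]_m -> 'M[R[i]]_m) : Prop :=
  forall (i j l : 'I_m) z v, D z -> v != 0 ->
    horizontal_coef F i j l z v = chern_coef g i j l z.

(* K^i_j = g^{betabar alpha} R^i_{j alpha betabar} *)
Definition mean_curvature (R : realType) (m : nat)
    (F : 'rV[R[i]]_m -> 'rV[R[i]]_m -> R) (g : 'rV[R[i]]_m -> 'M[R[i]]_m)
    (i j : 'I_m) (z v : 'rV[R[i]]_m) : R[i] :=
  \sum_a \sum_b invmx (g z) b a * curvature F i j a b z v.

Record kahler_finsler_einstein (R : realType) (m : nat)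
    (D : set 'rV[R[i]]_m) (F : 'rV[R[i]]_m -> 'rV[R[i]]_m -> R)
    (g : 'rV[R[i]]_m -> 'M[R[i]]_m) (phi : R) : Prop := KahlerFinslerEinstein {
  kfe_kahler_berwald : kahler_berwald D F;
  kfe_hermitian : hermitian_metric D g;
  kfe_compatible : chern_compatible D F g;
  kfe_einstein : forall (i j : 'I_m) z v, D z -> v != 0 ->
    mean_curvature F g i j z v = phi%:C%C * (i == j)%:R }.

Definition polydisc (R : realType) (m : nat) : set 'rV[R[i]]_m :=
  [set z | forall l, Normc.normc (z 0 l) < 1].

Definition Ftk (R : realType) (m : nat) (t : R) (k : nat)
    (z v : 'rV[R[i]]_m) : R :=
  (Num.sqrt (1 + t))^-1 *
  Num.sqrt (\sum_l Normc.normc (v 0 l) ^+ 2 / (1 - Normc.normc (z 0 l) ^+ 2) ^+ 2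
            + t * (\sum_l Normc.normc (v 0 l) ^+ (2 * k)
                          / (1 - Normc.normc (z 0 l) ^+ 2) ^+ (2 * k))
                  `^ (k%:R^-1)).

Definition bergman (R : realType) (m : nat) (z : 'rV[R[i]]_m) :
    'M[R[i]]_m :=
  \matrix_(a, b) ((a == b)%:R * ((1 - Normc.normc (z 0 a) ^+ 2) ^- 2)%:C%C).

(* Main.v *)
(** Write F^2 = G(u_1, ..., u_m) with u_l = |v^l|^2 / (1 - |z^l|^2)^2 and
    G(u) = (sum u_l + t (sum u_l^k)^(1/k)) / (1 + t). Since u_l depends only on
    z^l and v^l, the chain rule gives
      dF^2/dz^l = c_l v^l dF^2/dv^l,   c_l = 2 conj(z^l) / (1 - |z^l|^2),
    whence d^2F^2/dconj(v^s)dz^l = c_l v^l G_(l sbar). As the Levi matrix is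
    invertible, Gamma^i_(;l) = delta_il c_l v^l, independently of t and k; these
    are the coefficients of the Chern connection of the Bergman metric. Finally
    dc_l/dconj(z^b) = 2 delta_lb / (1 - |z^l|^2)^2, and contracting with the
    inverse of the Bergman metric leaves the constant -2. *)

Require Import Defs.
From mathcomp Require Import all_boot all_order all_algebra.
From mathcomp Require Import complex.
From mathcomp Require Import all_classical all_reals all_analysis.
From mathcomp Require Import ring.

Set Implicit Arguments.
Unset Strict Implicit.
Unset Printing Implicit Defensive.

Import Order.TTheory GRing.Theory Num.Theory.
Import numFieldNormedType.Exports.

Local Open Scope classical_set_scope.
Local Open Scope complex_scope.
Local Open Scope ring_scope.

(** * Calculus of functions of class C^n *)

(** The invertibility of the Levi matrix comes from strong pseudoconvexity, and this is the one
    place where an inequality decides. As 1/k - 1 is negative, the Hessian of the k-th root contains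
    a nonpositive rank-one term with factor -(k - 1). The diagonal gains k times the quantity that
    bounds it by Cauchy-Schwarz, so exactly one copy is left over, and the Hermitian part of the
    metric gives strictness. The k-th root is smooth only where S = sum u_l^k is positive, that is,
    off the zero section; continuity of F across v = 0 is a separate argument. The derivatives in
    the definitions are total functions, so the computations go through a relation, [has_wirtinger],
    that asserts existence together with the value. The closed formulas hold only for v <> 0 and z
    in the polydisc; each further differentiation replaces a function by its formula near the
    point. *)

Lemma Cn_pred (R : realType) (V : normedModType R) n (U : set V) (f : V -> R) :
  Cn n.+1 U f -> Cn n U f.
Proof.
elim: n f => [|n IH] f [cf df]; first by [].
split=> // v; have [d1 d2] := df v; split=> //; exact: IH.
Qed.

Lemma Cn_continuous (R : realType) (V : normedModType R) n (U : set V)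
    (f : V -> R) : Cn n U f -> forall x, U x -> {for x, continuous f}.
Proof. by case: n => [|n] []. Qed.

(** Continuity and derivatives at a point of an open set depend only on nearby values. This lets the
    inductions below replace a derivative by a formula valid on U alone. *)
Lemma eq_Cn (R : realType) (V : normedModType R) n (U : set V)
    (f g : V -> R) : open U -> (forall x, U x -> f x = g x) ->
  Cn n U f -> Cn n U g.
Proof.
move=> oU.
have near_fg (h h' : V -> R) x : (forall x, U x -> h x = h' x) -> U x ->
    \forall y \near x, h y = h' y.
  by move=> hh' Ux; apply: filterS (open_nbhs_nbhs (conj oU Ux)) => y; exact: hh'.
have cont_fg (h h' : V -> R) x : (forall x, U x -> h x = h' x) -> U x ->
    {for x, continuous h} -> {for x, continuous h'}.
  move=> hh' Ux; rewrite /prop_for /continuous_at (hh' x Ux).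
  by apply: cvg_trans; apply: near_eq_cvg; exact: near_fg.
elim: n f g => [|n IH] f g fg [cf df].
  by split=> // x Ux; apply: cont_fg fg Ux (cf x Ux).
split=> [x Ux|v]; first by apply: cont_fg fg Ux (cf x Ux).
have [d1 d2] := df v; split=> [x Ux|].
  exact: near_eq_derivable (near_fg _ _ _ fg Ux) (d1 x Ux).
by apply: (IH _ _ _ d2) => x Ux; apply: near_eq_derive; exact: near_fg.
Qed.

Lemma Cn_cst (R : realType) (V : normedModType R) n (U : set V) (c : R) :
  Cn n U (fun=> c).
Proof.
elim: n c => [|n IH] c; first by split=> // x _; exact: cvg_cst.
split=> [x _|v]; first exact: cvg_cst.
split=> [x _|]; first exact: derivable_cst.
have -> : 'D_v (fun=> c) = (fun=> 0) :> (V -> R); last exact: IH.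
by apply/funext => x; exact: derive_cst.
Qed.

Lemma CnD (R : realType) (V : normedModType R) n (U : set V) (f g : V -> R) :
  open U -> Cn n U f -> Cn n U g -> Cn n U (fun x => f x + g x).
Proof.
move=> oU; elim: n f g => [|n IH] f g [cf df] [cg dg].
  by split=> // x Ux; apply: cvgD; [exact: cf|exact: cg].
split=> [x Ux|v]; first by apply: cvgD; [exact: cf|exact: cg].
have [df1 df2] := df v; have [dg1 dg2] := dg v.
split=> [x Ux|]; first by apply: derivableD; auto.
apply: (eq_Cn oU _ (IH _ _ df2 dg2)) => // x Ux.
by rewrite deriveD //; auto.
Qed.

(** The Leibniz rule multiplies a derivative of one factor by the other factor undifferentiated, so
    the induction also uses f and g themselves at the lower order, through [Cn_pred]. *)
Lemma CnM (R : realType) (V : normedModType R) n (U : set V) (f g : V -> R) :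
  open U -> Cn n U f -> Cn n U g -> Cn n U (fun x => f x * g x).
Proof.
move=> oU; elim: n f g => [|n IH] f g Cf Cg.
  by split=> // x Ux; apply: cvgM; [exact: (Cn_continuous Cf)
                                   |exact: (Cn_continuous Cg)].
split=> [x Ux|v].
  by apply: cvgM; [exact: (Cn_continuous Cf)|exact: (Cn_continuous Cg)].
have [df1 df2] := Cf.2 v; have [dg1 dg2] := Cg.2 v.
split=> [x Ux|]; first by apply: derivableM; auto.
have Cf' := Cn_pred Cf; have Cg' := Cn_pred Cg.
apply: (eq_Cn oU _ (CnD oU (IH _ _ Cf' dg2) (IH _ _ Cg' df2))) => // x Ux.
by rewrite deriveM //; auto.
Qed.

(** Reduces a directional derivative to one real variable, where the chain rule for [powR]
    applies. *)
Lemma derive_line (R : realType) (V : normedModType R) (f : V -> R) (x v : V) :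
  'D_v f x = 'D_1 (fun h : R => f (h *: v + x)) 0.
Proof.
rewrite /derive; set g1 := fun h => h^-1 *: _; set g2 := fun h => h^-1 *: _.
suff -> : g1 = g2 by [].
by rewrite funeqE /g1 /g2 => h /=; rewrite addr0 scale0r add0r [_%:A]mulr1.
Qed.

Lemma is_derive_lineP (R : realType) (V : normedModType R) (f : V -> R)
    (x v : V) (df : R) :
  is_derive x v f df <-> is_derive (0 : R) 1 (fun h : R => f (h *: v + x)) df.
Proof.
split=> -[d1 <-].
  by apply: DeriveDef; [exact: (derivable1P _ _ _).1|rewrite -derive_line].
by apply: DeriveDef; [exact: (derivable1P _ _ _).2|rewrite derive_line].
Qed.

Lemma is_derive_powR (R : realType) (V : normedModType R) (f : V -> R)
    (p : R) (x v : V) (df : R) : 0 < f x -> is_derive x v f df ->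
  is_derive x v (fun y => f y `^ p) (p * f x `^ (p - 1) * df).
Proof.
move=> fx0 /is_derive_lineP dh; apply/is_derive_lineP.
have fx0' : 0 < f (0 *: v + x) by rewrite scale0r add0r.
have := @is_derive1_comp _ (fun y => y `^ p) (fun h : R => f (h *: v + x)) 0
  _ _ (is_derive1_powR p fx0') dh.
by rewrite scale0r add0r.
Qed.

(** The exponent varies in the induction, since differentiating f^p produces f^(p - 1). *)
Lemma Cn_powR (R : realType) (V : normedModType R) n (U : set V) (f : V -> R)
    (p : R) : open U -> (forall x, U x -> 0 < f x) -> Cn n U f ->
  Cn n U (fun x => f x `^ p).
Proof.
move=> oU f0; elim: n p => [|n IH] p Cf.
  split=> // x Ux.
  have := @continuous_comp _ _ _ f (fun y => y `^ p) x (Cn_continuous Cf Ux).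
  apply; apply/differentiable_continuous/derivable1_diffP.
  by have [] := is_derive1_powR p (f0 x Ux).
split=> [x Ux|v].
  have := @continuous_comp _ _ _ f (fun y => y `^ p) x (Cn_continuous Cf Ux).
  apply; apply/differentiable_continuous/derivable1_diffP.
  by have [] := is_derive1_powR p (f0 x Ux).
have [df1 df2] := Cf.2 v.
have dp x : U x ->
    is_derive x v (fun y => f y `^ p) (p * f x `^ (p - 1) * 'D_v f x).
  by move=> Ux; apply: is_derive_powR; [exact: f0|exact/derivableP/df1].
split=> [x Ux|]; first by have [] := dp x Ux.
have CP := CnM oU (CnM oU (Cn_cst n U p) (IH (p - 1) (Cn_pred Cf))) df2.
apply: (eq_Cn oU _ CP) => // x Ux.
by have [_ ->] := dp x Ux.
Qed.

(** The difference quotient in direction v equals [f v] for every h <> 0, so the first derivatives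
    are constant. *)
Lemma Cn_linear (R : realType) (V : normedModType R) n (U : set V)
    (f : V -> R) : (forall a x y, f (a *: x + y) = a * f x + f y) ->
  continuous f -> Cn n U f.
Proof.
move=> lf cf; case: n => [|n]; first by split=> // x _; exact: cf.
split=> [x _|v]; first exact: cf.
have dfv x : is_derive x v f (f v).
  have E : \forall h \near 0^', h^-1 *: ((f \o shift x) (h *: v) - f x) = f v.
    near=> h; rewrite /= lf addrK [_ *: _]mulrA mulVf ?mul1r //.
    by near: h; exact: nbhs_dnbhs_neq.
  have L : (fun h => h^-1 *: ((f \o shift x) (h *: v) - f x)) @ 0^' --> f v.
    by apply: cvg_near_cst.
  by apply: DeriveDef; [apply/cvg_ex; exists (f v)|exact: cvg_lim L].
split=> [x _|]; first by have [] := dfv x.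
have -> : 'D_v f = (fun=> f v) :> (V -> R); last exact: Cn_cst.
by apply/funext => x; have [] := dfv x.
Unshelve. all: by end_near. Qed.

Lemma CnV (R : realType) (V : normedModType R) n (U : set V) (f : V -> R) :
  open U -> (forall x, U x -> 0 < f x) -> Cn n U f ->
  Cn n U (fun x => (f x)^-1).
Proof.
move=> oU f0 Cf; apply: (eq_Cn oU _ (Cn_powR (-1) oU f0 Cf)) => x Ux.
by rewrite powR_inv1 // ltW ?f0.
Qed.

Lemma CnX (R : realType) (V : normedModType R) n (U : set V) (f : V -> R) k :
  open U -> Cn n U f -> Cn n U (fun x => f x ^+ k).
Proof.
move=> oU Cf; elim: k => [|k IH]; first exact: (Cn_cst n U 1).
by apply: (eq_Cn oU _ (CnM oU Cf IH)) => x _; rewrite exprS.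
Qed.

Lemma Cn_sum (R : realType) (V : normedModType R) n (U : set V) (I : finType)
    (f : I -> V -> R) : open U -> (forall i, Cn n U (f i)) ->
  Cn n U (fun x => \sum_i f i x).
Proof.
move=> oU Cf; rewrite (_ : (fun x => _) = \sum_i f i); last first.
  by apply/funext => x; rewrite fct_sumE.
elim/big_rec: _ => [|i g _ Cg]; first exact: Cn_cst.
exact: CnD.
Qed.

(** * Wirtinger derivatives *)

Lemma ReD (R : realType) (x y : R[i]) :
  complex.Re (x + y) = complex.Re x + complex.Re y.
Proof. by case: x y => ? ? []. Qed.

Lemma ImD (R : realType) (x y : R[i]) :
  complex.Im (x + y) = complex.Im x + complex.Im y.
Proof. by case: x y => ? ? []. Qed.

Lemma ReM (R : realType) (x y : R[i]) : complex.Re (x * y) =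
  complex.Re x * complex.Re y - complex.Im x * complex.Im y.
Proof. by case: x y => ? ? []. Qed.

Lemma ImM (R : realType) (x y : R[i]) : complex.Im (x * y) =
  complex.Re x * complex.Im y + complex.Im x * complex.Re y.
Proof. by case: x y => ? ? []. Qed.

(** Relational form of [rderive0]: the latter has a value even where no derivative exists, while the
    sum and product rules require existence. *)
Definition cderiv (R : realType) (h : R -> R[i]) (c : R[i]) : Prop :=
  is_derive (0 : R) 1 (fun s => complex.Re (h s)) (complex.Re c) /\
  is_derive (0 : R) 1 (fun s => complex.Im (h s)) (complex.Im c).

Lemma cderiv_rderive0 (R : realType) (h : R -> R[i]) (c : R[i]) :
  cderiv h c -> rderive0 h = c.
Proof. by case: c => a b [/= [_ e1] [_ e2]]; rewrite /rderive0 !derive1E e1 e2. Qed.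

Lemma near_eq_cderiv (R : realType) (h g : R -> R[i]) (c : R[i]) :
  (\forall s \near (0 : R), h s = g s) -> cderiv h c -> cderiv g c.
Proof.
move=> hg [d1 d2]; split.
  by apply: near_eq_is_derive d1; apply: filterS hg => s ->.
by apply: near_eq_is_derive d2; apply: filterS hg => s ->.
Qed.

Lemma cderiv_cst (R : realType) (c : R[i]) : cderiv (fun=> c) 0.
Proof. by split; exact: is_derive_cst. Qed.

Lemma cderivD (R : realType) (h g : R -> R[i]) (c d : R[i]) :
  cderiv h c -> cderiv g d -> cderiv (fun s => h s + g s) (c + d).
Proof.
move=> [h1 h2] [g1 g2]; split.
  rewrite ReD; have := is_deriveD h1 g1.
  by congr is_derive; apply/funext => s /=; rewrite ReD.
rewrite ImD; have := is_deriveD h2 g2.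
by congr is_derive; apply/funext => s /=; rewrite ImD.
Qed.

Lemma cderivM (R : realType) (h g : R -> R[i]) (c d : R[i]) :
  cderiv h c -> cderiv g d -> cderiv (fun s => h s * g s) (h 0 * d + g 0 * c).
Proof.
move=> [h1 h2] [g1 g2]; split.
  have := is_deriveB (is_deriveM h1 g1) (is_deriveM h2 g2).
  rewrite (_ : _ - _ = complex.Re (h 0 * d + g 0 * c)); last first.
    by rewrite ReD !ReM /GRing.scale /=; ring.
  by congr is_derive; apply/funext => s /=; rewrite ReM.
have := is_deriveD (is_deriveM h1 g2) (is_deriveM h2 g1).
rewrite (_ : _ + _ = complex.Im (h 0 * d + g 0 * c)); last first.
  by rewrite ImD !ImM /GRing.scale /=; ring.
by congr is_derive; apply/funext => s /=; rewrite ImM.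
Qed.

Lemma cderiv_conj (R : realType) (h : R -> R[i]) (c : R[i]) :
  cderiv h c -> cderiv (fun s => (h s)^*%C) c^*%C.
Proof.
have ReJ (x : R[i]) : complex.Re x^*%C = complex.Re x by case: x.
have ImJ (x : R[i]) : complex.Im x^*%C = - complex.Im x by case: x.
move=> [h1 h2]; split.
  by rewrite ReJ; move: h1; congr is_derive; apply/funext => s; rewrite ReJ.
rewrite ImJ; have := is_deriveN h2.
by congr is_derive; apply/funext => s; rewrite ImJ.
Qed.

Lemma cderiv_powR (R : realType) (h : R -> R) (p : R) (c : R[i]) : 0 < h 0 ->
  cderiv (fun s => (h s)%:C) c ->
  cderiv (fun s => (h s `^ p)%:C) ((p * h 0 `^ (p - 1))%:C * c).
Proof.
move=> h0 [/= h1 h2].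
(* The imaginary part of a real function is constantly 0, so c is real by uniqueness of the
   derivative. *)
have c0 : complex.Im c = 0.
  by case: h2 => _ <-; have [_ ->] := is_derive_cst (0 : R) (0 : R) (1 : R).
case: c c0 h1 h2 => a b /= -> h1 h2; split => /=.
  by rewrite mul0r subr0; exact: is_derive_powR.
by rewrite mulr0 mul0r addr0; exact: h2.
Qed.

Definition cline (R : realType) m (l : 'I_m) (d : R[i]) (z : 'rV[R[i]]_m)
    (s : R) : 'rV[R[i]]_m := z + (s%:C * d) *: delta_mx 0 l.

Lemma cline0 (R : realType) m (l : 'I_m) (d : R[i]) (z : 'rV[R[i]]_m) :
  cline l d z 0 = z.
Proof. by rewrite /cline mul0r scale0r addr0. Qed.

Lemma clineE (R : realType) m (l j : 'I_m) (d : R[i]) (z : 'rV[R[i]]_m) s :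
  cline l d z s 0 j = z 0 j + s%:C * (d * (j == l)%:R).
Proof. by rewrite !mxE /= mulrA. Qed.

(* a = df/dz^l and b = df/dconj(z^l): along the direction d the derivative is
   a d + b conj(d); d = 1 and d = i recover the partials in x^l and y^l. *)
Definition has_wirtinger (R : realType) m (l : 'I_m)
    (f : 'rV[R[i]]_m -> R[i]) (z : 'rV[R[i]]_m) (a b : R[i]) : Prop :=
  forall d : R[i], cderiv (fun s => f (cline l d z s)) (a * d + b * d^*%C).

Lemma has_wirtinger_partial (R : realType) m (l : 'I_m)
    (f : 'rV[R[i]]_m -> R[i]) (z : 'rV[R[i]]_m) (a b : R[i]) :
  has_wirtinger l f z a b ->
  partial_x l f z = a + b /\ partial_y l f z = 'i * (a - b).
Proof.
move=> w; split; rewrite /partial_x /partial_y.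
  have := w 1; rewrite !mulr1 rmorph1 mulr1 => /cderiv_rderive0 <-.
  by congr rderive0; apply/funext => s; rewrite /cline mulr1.
have := w 'i; rewrite (_ : ('i)^*%C = - 'i); last by simpc.
rewrite mulrN -mulrBl mulrC => /cderiv_rderive0 <-.
congr rderive0; apply/funext => s; rewrite /cline.
by rewrite (_ : s%:C * 'i = 0 +i* s) //; simpc.
Qed.

Lemma has_wirtinger_dz (R : realType) m (l : 'I_m)
    (f : 'rV[R[i]]_m -> R[i]) (z : 'rV[R[i]]_m) (a b : R[i]) :
  has_wirtinger l f z a b -> dz l f z = a.
Proof.
move=> /has_wirtinger_partial[px py]; rewrite /dz px py.
rewrite mulrA -expr2 sqr_i mulN1r opprK addrACA subrr addr0 -mulr2n.
by rewrite -(mulr_natl a) mulKf // pnatr_eq0.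
Qed.

Lemma has_wirtinger_dzbar (R : realType) m (l : 'I_m)
    (f : 'rV[R[i]]_m -> R[i]) (z : 'rV[R[i]]_m) (a b : R[i]) :
  has_wirtinger l f z a b -> dzbar l f z = b.
Proof.
move=> /has_wirtinger_partial[px py]; rewrite /dzbar px py.
rewrite mulrA -expr2 sqr_i mulN1r opprB (_ : a + b + (b - a) = b *+ 2); last by ring.
by rewrite -(mulr_natl b) mulKf // pnatr_eq0.
Qed.

(** [has_wirtinger] sees a function only along the lines [cline l d z], so nearness is asked line by
    line, in the topology of R. *)
Definition near_lines (R : realType) m (l : 'I_m) (z : 'rV[R[i]]_m)
    (P : set 'rV[R[i]]_m) : Prop :=
  forall d : R[i], \forall s \near (0 : R), P (cline l d z s).

Lemma near_eq_has_wirtinger (R : realType) m (l : 'I_m)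
    (f g : 'rV[R[i]]_m -> R[i]) (z : 'rV[R[i]]_m) (a b : R[i]) :
  near_lines l z (fun x => f x = g x) ->
  has_wirtinger l f z a b -> has_wirtinger l g z a b.
Proof. by move=> fg w d; apply: near_eq_cderiv (fg d) (w d). Qed.

Lemma has_wirtinger_cst (R : realType) m (l : 'I_m) (c : R[i])
  (z : 'rV[R[i]]_m) : has_wirtinger l (fun=> c) z 0 0.
Proof. by move=> d; rewrite !mul0r addr0; exact: cderiv_cst. Qed.

Lemma has_wirtingerD (R : realType) m (l : 'I_m)
    (f g : 'rV[R[i]]_m -> R[i]) (z : 'rV[R[i]]_m) (a b a' b' : R[i]) :
  has_wirtinger l f z a b -> has_wirtinger l g z a' b' ->
  has_wirtinger l (fun x => f x + g x) z (a + a') (b + b').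
Proof. by move=> wf wg d; rewrite !mulrDl addrACA; exact: cderivD. Qed.

Lemma has_wirtinger_sum (R : realType) m (l : 'I_m) (I : finType)
    (f : I -> 'rV[R[i]]_m -> R[i]) (z : 'rV[R[i]]_m) (a b : I -> R[i]) :
  (forall i, has_wirtinger l (f i) z (a i) (b i)) ->
  has_wirtinger l (fun x => \sum_i f i x) z (\sum_i a i) (\sum_i b i).
Proof.
move=> w; rewrite (_ : (fun x => _) = \sum_i f i); last first.
  by apply/funext => x; rewrite fct_sumE.
elim/big_rec3: _ => [|i a' b' f' _ IH]; first exact: has_wirtinger_cst.
exact: has_wirtingerD.
Qed.

Lemma has_wirtingerM (R : realType) m (l : 'I_m)
    (f g : 'rV[R[i]]_m -> R[i]) (z : 'rV[R[i]]_m) (a b a' b' : R[i]) :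
  has_wirtinger l f z a b -> has_wirtinger l g z a' b' ->
  has_wirtinger l (fun x => f x * g x) z
    (f z * a' + g z * a) (f z * b' + g z * b).
Proof.
move=> wf wg d; have := cderivM (wf d) (wg d); rewrite !cline0.
by congr cderiv; ring.
Qed.

Lemma has_wirtingerZ (R : realType) m (l : 'I_m) (c : R[i])
    (f : 'rV[R[i]]_m -> R[i]) (z : 'rV[R[i]]_m) (a b : R[i]) :
  has_wirtinger l f z a b ->
  has_wirtinger l (fun x => c * f x) z (c * a) (c * b).
Proof.
move=> /(has_wirtingerM (has_wirtinger_cst l c z)).
by rewrite !mulr0 !addr0.
Qed.

Lemma has_wirtingerX (R : realType) m (l : 'I_m) n
    (f : 'rV[R[i]]_m -> R[i]) (z : 'rV[R[i]]_m) (a b : R[i]) :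
  has_wirtinger l f z a b ->
  has_wirtinger l (fun x => f x ^+ n) z
    (n%:R * f z ^+ n.-1 * a) (n%:R * f z ^+ n.-1 * b).
Proof.
move=> w; elim: n => [|n IH]; first by rewrite !mul0r; exact: has_wirtinger_cst.
have := has_wirtingerM w IH.
rewrite (_ : (fun x => f x * f x ^+ n) = (fun x => f x ^+ n.+1)); last first.
  by apply/funext => x; rewrite exprS.
(* The identity n.-1 + 1 = n fails at n = 0, where the factor n%:R vanishes instead. *)
congr has_wirtinger; case: n {IH} => [|n] /=;
  rewrite ?expr0 ?mul0r ?mulr0 ?add0r ?mul1r // exprS; ring.
Qed.

Lemma has_wirtinger_conj (R : realType) m (l : 'I_m)
    (f : 'rV[R[i]]_m -> R[i]) (z : 'rV[R[i]]_m) (a b : R[i]) :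
  has_wirtinger l f z a b -> has_wirtinger l (fun x => (f x)^*%C) z b^*%C a^*%C.
Proof.
move=> w d; have := cderiv_conj (w d).
rewrite (rmorphD conjc) !(rmorphM conjc) /=.
by rewrite (_ : d^*%C^*%C = d) 1?addrC //; exact: conjcK.
Qed.

Lemma has_wirtinger_coord (R : realType) m (l j : 'I_m) (z : 'rV[R[i]]_m) :
  has_wirtinger l (fun x => x 0 j) z (j == l)%:R 0.
Proof.
move=> d; rewrite mul0r addr0 mulrC.
rewrite (_ : (fun s => _) = fun s : R => z 0 j + s%:C * (d * (j == l)%:R));
  last by apply/funext => s; rewrite clineE.
have w1 : cderiv (fun s : R => s%:C) 1.
  by split; [exact: is_derive_id|exact: is_derive_cst].
have := cderivD (cderiv_cst (z 0 j))
  (cderivM w1 (cderiv_cst (d * (j == l)%:R))).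
by rewrite mulr0 !add0r mulr1.
Qed.

Lemma has_wirtinger_powR (R : realType) m (l : 'I_m) (p : R)
    (f : 'rV[R[i]]_m -> R) (z : 'rV[R[i]]_m) (a b : R[i]) : 0 < f z ->
  has_wirtinger l (fun x => (f x)%:C) z a b ->
  has_wirtinger l (fun x => (f x `^ p)%:C) z
    ((p * f z `^ (p - 1))%:C * a) ((p * f z `^ (p - 1))%:C * b).
Proof.
move=> f0 w d; rewrite -!mulrA -mulrDr -[in f z](cline0 l d z).
by apply: (@cderiv_powR _ (fun s => f (cline l d z s))); rewrite ?cline0.
Qed.

(** * The metric as a complex Finsler metric *)

Lemma continuous_powR_ge0 (R : realType) (T : topologicalType) (f : T -> R)
    (a : R) (p : T) : 0 < a -> (forall x, 0 <= f x) ->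
  {for p, continuous f} -> {for p, continuous (fun x => f x `^ a)}.
Proof.
move=> a0 f0 cf; have := f0 p; rewrite le_eqVlt => /orP[/eqP fp0|fp0]; last first.
  have := @continuous_comp _ _ _ f (fun y => y `^ a) p cf.
  apply; apply/differentiable_continuous/derivable1_diffP.
  by have [] := is_derive1_powR a fp0.
rewrite /prop_for /continuous_at -fp0 powR0 ?gt_eqF //.
apply/cvgr0Pnorm_lt => e e0; near=> x.
rewrite ger0_norm ?powR_ge0 //.
have -> : e = (e `^ a^-1) `^ a by rewrite -powRrM mulVf ?gt_eqF // powRr1 // ltW.
apply: gt0_ltr_powR; rewrite ?nnegrE ?powR_ge0 //.
by near: x; apply: cvgr_lt cf _ _; rewrite -fp0 powR_gt0.
Unshelve. all: by end_near. Qed.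

Lemma sqr_normcE (R : realType) (x : R[i]) :
  Normc.normc x ^+ 2 = complex.Re x ^+ 2 + complex.Im x ^+ 2.
Proof. by case: x => a b /=; rewrite sqr_sqrtr // addr_ge0 ?sqr_ge0. Qed.

Lemma sqr_normcM (R : realType) (x : R[i]) :
  (Normc.normc x ^+ 2)%:C = x * x^*%C.
Proof.
case: x => a b; rewrite sqr_normcE /=.
by apply/eqP; rewrite eq_complex /=; apply/andP; split; apply/eqP; ring.
Qed.

Lemma normc_ge0 (R : realType) (x : R[i]) : 0 <= Normc.normc x.
Proof. by case: x => a b; exact: sqrtr_ge0. Qed.

Lemma sqr_normc_gt0 (R : realType) (x : R[i]) :
  (0 < Normc.normc x ^+ 2) = (x != 0).
Proof.
rewrite exprn_even_gt0 //=; apply/idP/idP; apply: contraNN => /eqP.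
  by move=> ->; rewrite Normc.normc0.
by move=> /Normc.eq0_normc ->.
Qed.

Lemma sqr_normc_lt1 (R : realType) (x : R[i]) :
  (Normc.normc x ^+ 2 < 1) = (Normc.normc x < 1).
Proof. by rewrite expr_lt1 // normc_ge0. Qed.

Definition uval (R : realType) m (z v : 'rV[R[i]]_m) (l : 'I_m) : R :=
  Normc.normc (v 0 l) ^+ 2 / (1 - Normc.normc (z 0 l) ^+ 2) ^+ 2.

Definition Gtk (R : realType) m (t : R) k (u : 'I_m -> R) : R :=
  (1 + t)^-1 * (\sum_l u l + t * (\sum_l u l ^+ k) `^ k%:R^-1).

Lemma uval_ge0 (R : realType) m (z v : 'rV[R[i]]_m) (l : 'I_m) : 0 <= uval z v l.
Proof. by rewrite mulr_ge0 ?invr_ge0 ?sqr_ge0. Qed.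

Lemma FtkE (R : realType) m (t : R) k (z v : 'rV[R[i]]_m) :
  Ftk t k z v = (Num.sqrt (1 + t))^-1 *
  Num.sqrt (\sum_l uval z v l + t * (\sum_l uval z v l ^+ k) `^ k%:R^-1).
Proof.
rewrite /Ftk; congr (_ * Num.sqrt (_ + _ * _ `^ _)).
by apply: eq_bigr => l _; rewrite !exprM -expr_div_n.
Qed.

Lemma Ftk_sqr (R : realType) m (t : R) k (z v : 'rV[R[i]]_m) : 0 <= t ->
  Ftk t k z v ^+ 2 = Gtk t k (uval z v).
Proof.
move=> t0; rewrite FtkE exprMn exprVn !sqr_sqrtr ?addr_ge0 //.
- by apply: sumr_ge0 => l _; exact: uval_ge0.
- by rewrite mulr_ge0 // powR_ge0.
Qed.

Lemma polydisc_subr_gt0 (R : realType) m (z : 'rV[R[i]]_m) (l : 'I_m) :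
  polydisc z -> 0 < 1 - Normc.normc (z 0 l) ^+ 2.
Proof. by move=> Dz; rewrite subr_gt0 sqr_normc_lt1. Qed.

Lemma uval_gt0 (R : realType) m (z v : 'rV[R[i]]_m) (l : 'I_m) :
  polydisc z -> (0 < uval z v l) = (v 0 l != 0).
Proof.
move=> Dz; rewrite -sqr_normc_gt0 /uval pmulr_lgt0 // invr_gt0 exprn_gt0 //.
exact: polydisc_subr_gt0.
Qed.

Lemma row_neq0P (R : realType) m (v : 'rV[R[i]]_m) :
  reflect (exists l, v 0 l != 0) (v != 0).
Proof.
apply: (iffP idP) => [v0|[l vl]]; last first.
  by apply: contraNN vl => /eqP ->; rewrite mxE.
apply/existsP; apply: contraNT v0; rewrite negb_exists => /forallP v0.
by apply/eqP/rowP => l; rewrite mxE; apply/eqP/negPn/v0.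
Qed.

(** Keeps the base of the k-th root in the region where real powers are smooth. *)
Lemma sum_uvalX_gt0 (R : realType) m k (z v : 'rV[R[i]]_m) :
  polydisc z -> v != 0 -> 0 < \sum_l uval z v l ^+ k.
Proof.
move=> Dz /row_neq0P[j vj]; rewrite (bigD1 j) //= ltr_wpDr //.
  by apply: sumr_ge0 => l _; rewrite exprn_ge0 ?uval_ge0.
by rewrite exprn_gt0 // uval_gt0.
Qed.

Lemma sqr_normc_ofreal (R : realType) m (p : 'rV[R]_m * 'rV[R]_m) l :
  Normc.normc (ofreal p 0 l) ^+ 2 = p.1 0 l ^+ 2 + p.2 0 l ^+ 2.
Proof. by rewrite sqr_normcE mxE. Qed.

(** The linear map f covers the identity of the base as well as the two projections of the tangent
    bundle, onto base point and onto vector. *)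
Lemma Cn_sqr_normc (R : realType) m (V : normedModType R) n (U : set V)
    (f : V -> 'rV[R]_m * 'rV[R]_m) l : open U ->
  (forall a x y, f (a *: x + y) = a *: f x + f y) -> continuous f ->
  Cn n U (fun p => Normc.normc (ofreal (f p) 0 l) ^+ 2).
Proof.
move=> oU lf cf.
rewrite (_ : (fun p => _) = fun p => (f p).1 0 l ^+ 2 + (f p).2 0 l ^+ 2);
  last by apply/funext => p; exact: sqr_normc_ofreal.
apply: CnD => //; apply: CnX => //; apply: Cn_linear => [a x y|].
- by rewrite lf !mxE.
- move=> x; apply: (@continuous_comp _ _ _ f (fun q => q.1 0 l)); first exact: cf.
  apply: (@continuous_comp _ _ _ fst (fun q : 'rV[R]_m => q 0 l)).
    exact: cvg_fst.
  exact: coord_continuous.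
- by rewrite lf !mxE.
- move=> x; apply: (@continuous_comp _ _ _ f (fun q => q.2 0 l)); first exact: cf.
  apply: (@continuous_comp _ _ _ snd (fun q : 'rV[R]_m => q 0 l)).
    exact: cvg_snd.
  exact: coord_continuous.
Qed.

Lemma continuous_sqr_normc (R : realType) m l :
  continuous (fun p : 'rV[R]_m * 'rV[R]_m => Normc.normc (ofreal p 0 l) ^+ 2).
Proof.
move=> p; apply: (@Cn_continuous _ _ 0%N setT) => //.
apply: (@Cn_sqr_normc _ _ _ _ _ id) => // [|x]; first exact: openT.
exact: cvg_id.
Qed.

Lemma open_polydisc (R : realType) m : open (@ofreal R m @^-1` @polydisc R m).
Proof.
rewrite openE => p Dp.
suff : \forall q \near p, forall l, Normc.normc (ofreal q 0 l) < 1 by [].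
apply: (@filter_forall _ _ (fun l q => is_true (Normc.normc (ofreal q 0 l) < 1))
  (nbhs p) _) => l.
have := @continuous_sqr_normc R m l p => /cvgr_lt => /(_ 1).
rewrite sqr_normc_lt1 => /(_ (Dp l)).
by apply: filterS => q; rewrite sqr_normc_lt1.
Qed.

Lemma open_ofreal_neq0 (R : realType) m :
  open [set p : 'rV[R]_m * 'rV[R]_m | ofreal p != 0].
Proof.
rewrite openE => p /row_neq0P[l]; rewrite -sqr_normc_gt0 => pl.
suff : \forall q \near p, ofreal q != 0 by [].
have /cvgr_gt := @continuous_sqr_normc R m l p.
move=> /(_ 0 pl); apply: filterS => q /=; rewrite sqr_normc_gt0 => ql.
by apply/row_neq0P; exists l.
Qed.

Lemma domain_polydisc (R : realType) m : is_domain (@polydisc R m).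
Proof.
split; first by exists 0 => l; rewrite mxE Normc.normc0.
  exact: open_polydisc.
(* The polydisc is star-shaped about 0: it is the union of the segments from 0 to its points, and
   these all share 0. *)
have -> : @ofreal R m @^-1` @polydisc R m =
    \bigcup_(p in @ofreal R m @^-1` @polydisc R m)
       ((fun s : R => s *: p) @` `[0, 1]).
  apply/seteqP; split=> [p Dp|p [q Dq [s /=]]].
    by exists p => //; exists 1; rewrite ?scale1r //= in_itv /= ler01 lexx.
  rewrite in_itv /= => /andP[s0 s1] <- l.
  rewrite -sqr_normc_lt1 sqr_normc_ofreal !mxE !exprMn -mulrDr -sqr_normc_ofreal.
  have := Dq l; rewrite -sqr_normc_lt1; apply: le_lt_trans.
  by rewrite ler_piMl ?sqr_ge0 // expr_le1.
apply: bigcup_connected.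
  by exists 0 => p Dp; exists 0; rewrite ?scale0r //= in_itv /= ler01 lexx.
move=> p Dp; apply: connected_continuous_connected.
  exact: segment_connected.
apply: continuous_subspaceT => s.
exact: scalel_continuous.
Qed.

Lemma Cn_uval (R : realType) m n (U : set (('rV[R]_m * 'rV[R]_m) * ('rV[R]_m * 'rV[R]_m))) l :
  open U -> U `<=` [set p | polydisc (ofreal p.1)] ->
  Cn n U (fun p => uval (ofreal p.1) (ofreal p.2) l).
Proof.
move=> oU UD; have U0 p (Up : U p) := polydisc_subr_gt0 l (UD p Up).
have cfst : continuous (@fst ('rV[R]_m * 'rV[R]_m) ('rV[R]_m * 'rV[R]_m)).
  by move=> p; exact: cvg_fst.
have csnd : continuous (@snd ('rV[R]_m * 'rV[R]_m) ('rV[R]_m * 'rV[R]_m)).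
  by move=> p; exact: cvg_snd.
have Cz := Cn_sqr_normc n l oU (fun _ _ _ => erefl) cfst.
have Cv := Cn_sqr_normc n l oU (fun _ _ _ => erefl) csnd.
have C1z : Cn n U (fun p => 1 - Normc.normc (ofreal p.1 0 l) ^+ 2).
  apply: (eq_Cn oU _ (CnD oU (Cn_cst n U 1) (CnM oU (Cn_cst n U (-1)) Cz))).
  by move=> p _; rewrite mulN1r.
apply: CnM => //; apply: CnV => // [p Up|]; first exact: exprn_gt0 (U0 p Up).
exact: CnX.
Qed.

Lemma open_polydisc_fst (R : realType) m (V : topologicalType) :
  open [set p : ('rV[R]_m * 'rV[R]_m) * V | polydisc (ofreal p.1)].
Proof.
apply: (@open_comp _ _ fst (@ofreal R m @^-1` @polydisc R m)).
  by move=> x _; exact: cvg_fst.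
exact: open_polydisc.
Qed.

Lemma continuous_Ftk (R : realType) m (t : R) k p : (0 < k)%N ->
  polydisc (ofreal2 p).1 ->
  {for p, continuous (fun q => Ftk t k (@ofreal2 R m q).1 (@ofreal2 R m q).2)}.
Proof.
move=> k0 Dp.
have oU := @open_polydisc_fst R m ('rV[R]_m * 'rV[R]_m)%type.
have cu l : {for p, continuous (fun q => uval (ofreal q.1) (ofreal q.2) l)}.
  exact: Cn_continuous (@Cn_uval R m 0%N _ l oU (fun _ => id)) _ Dp.
have cS : {for p, continuous
    (fun q => \sum_l uval (ofreal q.1) (@ofreal R m q.2) l ^+ k)}.
  apply: (Cn_continuous (Cn_sum oU _)) Dp => l.
  exact: CnX (@Cn_uval R m 0%N _ l oU (fun _ => id)).
have c1 : {for p, continuous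
    (fun q => \sum_l uval (ofreal q.1) (@ofreal R m q.2) l)}.
  by apply: (Cn_continuous (Cn_sum oU _)) Dp => l; exact: (@Cn_uval R m 0%N).
have k0' : (0 : R) < k%:R^-1 by rewrite invr_gt0 ltr0n.
pose G (q : ('rV[R]_m * 'rV[R]_m) * ('rV[R]_m * 'rV[R]_m)) :=
  \sum_l uval (ofreal q.1) (@ofreal R m q.2) l + t *
    (\sum_l uval (ofreal q.1) (@ofreal R m q.2) l ^+ k) `^ k%:R^-1.
have cG : {for p, continuous G}.
  apply: cvgD; first exact: c1.
  apply: cvgM; first exact: cvg_cst.
  apply: continuous_powR_ge0 k0' _ cS => q.
  by apply: sumr_ge0 => l _; rewrite exprn_ge0 ?uval_ge0.
rewrite (_ : (fun q => _) = fun q => (Num.sqrt (1 + t))^-1 * Num.sqrt (G q));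
  last by apply/funext => q; rewrite FtkE.
apply: cvgM; first exact: cvg_cst.
exact: continuous_comp cG (@sqrt_continuous R _).
Qed.

Lemma smooth_Ftk_sqr (R : realType) m (t : R) k : 0 <= t ->
  smooth (@ofreal2 R m @^-1` [set p | polydisc p.1 /\ p.2 != 0])
         (fun q => Ftk t k (@ofreal2 R m q).1 (@ofreal2 R m q).2 ^+ 2).
Proof.
move=> t0 n; set U := _ @^-1` _.
have oU : open U.
  apply: openI; first exact: open_polydisc_fst.
  apply: (@open_comp _ _ snd [set p : 'rV[R]_m * 'rV[R]_m | ofreal p != 0]).
    by move=> x _; exact: cvg_snd.
  exact: open_ofreal_neq0.
have Cu l : Cn n U (fun q => uval (ofreal q.1) (ofreal q.2) l).
  by apply: Cn_uval => // p [].
rewrite (_ : (fun q => _) = fun q => Gtk t k (uval (ofreal q.1) (@ofreal R m q.2)));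
  last by apply/funext => q; rewrite Ftk_sqr.
apply: CnM (Cn_cst n U _) _ => //; apply: CnD (Cn_sum oU Cu) _ => //.
apply: CnM (Cn_cst n U _) _ => //; apply: Cn_powR => // [q [Dq q0]|].
  exact: sum_uvalX_gt0.
by apply: Cn_sum => // l; exact: CnX.
Qed.

Lemma uvalZ (R : realType) m (z v : 'rV[R[i]]_m) (a : R[i]) l :
  uval z (a *: v) l = Normc.normc a ^+ 2 * uval z v l.
Proof. by rewrite /uval mxE Normc.normcM exprMn mulrA. Qed.

(** Each u_l scales by |a|^2, hence sum u_l^k by |a|^(2k) and its k-th root again by |a|^2. *)
Lemma Ftk_homogeneous (R : realType) m (t : R) k (z v : 'rV[R[i]]_m) (a : R[i]) :
  (0 < k)%N -> Ftk t k z (a *: v) = Normc.normc a * Ftk t k z v.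
Proof.
move=> k0; have a0 := normc_ge0 a.
rewrite !FtkE mulrCA; congr (_ * _).
under eq_bigr do rewrite uvalZ.
under [X in _ + _ * X `^ _]eq_bigr do rewrite uvalZ exprMn.
rewrite -!mulr_sumr powRM ?exprn_ge0 //; last first.
  by apply: sumr_ge0 => l _; rewrite exprn_ge0 ?uval_ge0.
rewrite -(powR_mulrn k (sqr_ge0 (Normc.normc a))) -powRrM mulfV ?pnatr_eq0 ?gtn_eqF//.
rewrite powRr1 ?sqr_ge0 // mulrCA -mulrDr sqrtrM ?sqr_ge0 //.
by rewrite sqrtr_sqr ger0_norm.
Qed.

Lemma Gtk_gt0 (R : realType) m (t : R) k (z v : 'rV[R[i]]_m) : 0 <= t ->
  polydisc z -> v != 0 -> 0 < Gtk t k (uval z v).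
Proof.
move=> t0 Dz v0; rewrite mulr_gt0 ?invr_gt0 ?ltr_wpDr //.
  by rewrite mulr_ge0 ?powR_ge0.
(* The first powers are the terms themselves by conversion. *)
by have := sum_uvalX_gt0 1 Dz v0.
Qed.

Lemma complex_finsler_Ftk (R : realType) m k (t : R) : (0 < k)%N -> 0 <= t ->
  complex_finsler (@polydisc R m) (@Ftk R m t k).
Proof.
move=> k0 t0; have F0 z v : 0 <= @Ftk R m t k z v.
  by rewrite FtkE mulr_ge0 ?invr_ge0 ?sqrtr_ge0.
split.
- exact: domain_polydisc.
- by move=> p Dp; exact: continuous_Ftk.
- exact: smooth_Ftk_sqr.
- by move=> z v _.
- move=> z v Dz; split=> [Fz0|->].
    apply/eqP/negP => /negP v0; have := Gtk_gt0 k t0 Dz v0.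
    by rewrite -Ftk_sqr // Fz0 expr0n ltxx.
  (* Homogeneity with a = 0. *)
  by rewrite -(scale0r 0) Ftk_homogeneous // Normc.normc0 mul0r.
- by move=> z v a _; exact: Ftk_homogeneous.
Qed.

(** * Cauchy-Schwarz inequalities with weights *)

(** Lagrange's identity: twice the difference of the two sides is the sum over i, j of p_i p_j (a_i
    b_j - a_j b_i)^2. *)
Lemma weighted_cauchy_schwarz (R : realType) (I : finType) (p a b : I -> R) :
  (forall i, 0 <= p i) ->
  (\sum_i p i * a i * b i) ^+ 2 <=
  (\sum_i p i * a i ^+ 2) * (\sum_i p i * b i ^+ 2).
Proof.
move=> p0; rewrite -(ler_pM2l (ltr0n R 2)) -subr_ge0.
set A := \sum_i p i * a i ^+ 2; set B := \sum_i p i * b i ^+ 2.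
rewrite (_ : _ - _ =
    \sum_i \sum_j p i * p j * (a i * b j - a j * b i) ^+ 2); last first.
  rewrite mulr_natl mulr2n {2}(mulrC A B) !big_distrlr /= expr2 big_distrlr /=.
  rewrite mulr_sumr -big_split -sumrB /=; apply: eq_bigr => i _.
  rewrite mulr_sumr -big_split -sumrB /=; apply: eq_bigr => j _.
  ring.
by apply: sumr_ge0 => i _; apply: sumr_ge0 => j _; rewrite mulr_ge0 ?sqr_ge0 ?mulr_ge0.
Qed.

Lemma normc_real (R : realType) (x : R) : Normc.normc x%:C = `|x|.
Proof. by rewrite /= expr0n /= addr0 sqrtr_sqr. Qed.

(** The triangle inequality reduces this to the real case for the moduli. *)
Lemma normc_cauchy_schwarz (R : realType) (I : finType) (p : I -> R)
    (x y : I -> R[i]) : (forall i, 0 <= p i) ->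
  Normc.normc (\sum_i (p i)%:C * x i * y i) ^+ 2 <=
  (\sum_i p i * Normc.normc (x i) ^+ 2) * (\sum_i p i * Normc.normc (y i) ^+ 2).
Proof.
move=> p0; apply: le_trans (weighted_cauchy_schwarz _ _ p0).
rewrite ler_sqr ?nnegrE ?normc_ge0 //; last first.
  by apply: sumr_ge0 => i _; rewrite !mulr_ge0 ?normc_ge0.
elim/big_rec2: _ => [|i u v _ uv]; first by rewrite Normc.normc0.
apply: le_trans (le_normcD _ _) _; rewrite lerD //.
by rewrite !Normc.normcM normc_real ger0_norm.
Qed.

(** * First and second derivatives of the squared metric *)

(** Wirtinger derivatives make f differentiable, hence continuous, along each line. *)
Lemma near_lines_gt (R : realType) m (l : 'I_m) (f : 'rV[R[i]]_m -> R) (c : R)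
    (z : 'rV[R[i]]_m) (a b : R[i]) :
  has_wirtinger l (fun x => (f x)%:C) z a b -> c < f z ->
  near_lines l z (fun x => c < f x).
Proof.
move=> w cz d; have [[df _] _] := w d.
have cf : {for 0, continuous (fun s : R => f (cline l d z s))}.
  exact/differentiable_continuous/derivable1_diffP.
by have /cvgr_gt := cf; apply; rewrite /= cline0.
Qed.

Lemma has_wirtinger_sqr_normc (R : realType) m (l j : 'I_m) (z : 'rV[R[i]]_m) :
  has_wirtinger l (fun x => (Normc.normc (x 0 j) ^+ 2)%:C) z
    ((j == l)%:R * (z 0 j)^*%C) ((j == l)%:R * z 0 j).
Proof.
have w := has_wirtinger_coord l j z.
have := has_wirtingerM w (has_wirtinger_conj w).
rewrite (_ : (fun x : 'rV[R[i]]_m => x 0 j * (x 0 j)^*%C) =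
  (fun x : 'rV[R[i]]_m => (Normc.normc (x 0 j) ^+ 2)%:C)); last first.
  by apply/funext => x; rewrite sqr_normcM.
congr has_wirtinger; rewrite ?conjc0 ?conjc_nat ?mulr0 ?add0r ?addr0 //.
  by rewrite mulrC.
by rewrite mulrC.
Qed.

Lemma near_lines_polydisc (R : realType) m (l : 'I_m) (z : 'rV[R[i]]_m) :
  polydisc z -> near_lines l z (@polydisc R m).
Proof.
move=> Dz d.
apply: (@filter_forall _ _
  (fun j s => is_true (Normc.normc (cline l d z s 0 j) < 1)) (nbhs (0 : R)) _) => j.
(* [near_lines_gt] propagates lower bounds, so |x_j|^2 < 1 enters as -1 < -|x_j|^2. *)
have w := has_wirtingerZ (-1) (has_wirtinger_sqr_normc l j z).
have w' : has_wirtinger l (fun x => (- (Normc.normc (x 0 j) ^+ 2))%:C) z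
    (-1 * ((j == l)%:R * (z 0 j)^*%C)) (-1 * ((j == l)%:R * z 0 j)).
  by move: w; congr has_wirtinger; apply/funext => x; rewrite mulN1r rmorphN.
have := near_lines_gt w' (_ : -1 < _).
rewrite ltrN2 sqr_normc_lt1 => /(_ (Dz j) d).
by apply: filterS => s; rewrite ltrN2 sqr_normc_lt1.
Qed.

Lemma near_lines_neq0 (R : realType) m (l : 'I_m) (v : 'rV[R[i]]_m) :
  v != 0 -> near_lines l v (fun u => u != 0).
Proof.
move=> /row_neq0P[j]; rewrite -sqr_normc_gt0 => vj d.
have := near_lines_gt (has_wirtinger_sqr_normc l j v) vj d.
by apply: filterS => s; rewrite sqr_normc_gt0 => sj; apply/row_neq0P; exists j.
Qed.

Lemma has_wirtingerXV (R : realType) m (l : 'I_m) n (f : 'rV[R[i]]_m -> R)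
    (z : 'rV[R[i]]_m) (a b : R[i]) : 0 < f z ->
  has_wirtinger l (fun x => (f x)%:C) z a b ->
  has_wirtinger l (fun x => (f x ^- n)%:C) z
    ((- n%:R * f z ^- n.+1)%:C * a) ((- n%:R * f z ^- n.+1)%:C * b).
Proof.
move=> f0 w; have := has_wirtinger_powR (- n%:R) f0 w.
rewrite -opprD (_ : n%:R + 1 = n.+1%:R) -?natr1 // natr1.
rewrite powR_invn ?ltW //; apply: near_eq_has_wirtinger => d.
apply: filterS (near_lines_gt w f0 d) => s fs.
by rewrite powR_invn // ltW.
Qed.

Lemma has_wirtinger_subr_sqr_normcXV (R : realType) m (l j : 'I_m) n (z : 'rV[R[i]]_m) :
  polydisc z ->
  has_wirtinger l (fun x => ((1 - Normc.normc (x 0 j) ^+ 2) ^- n)%:C) z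
    ((j == l)%:R * ((n%:R * (1 - Normc.normc (z 0 j) ^+ 2) ^- n.+1)%:C * (z 0 j)^*%C))
    ((j == l)%:R * ((n%:R * (1 - Normc.normc (z 0 j) ^+ 2) ^- n.+1)%:C * z 0 j)).
Proof.
move=> Dz; have z0 := polydisc_subr_gt0 j Dz.
have w : has_wirtinger l (fun x => (1 - Normc.normc (x 0 j) ^+ 2)%:C) z
    (0 + -1 * ((j == l)%:R * (z 0 j)^*%C)) (0 + -1 * ((j == l)%:R * z 0 j)).
  have := has_wirtingerD (has_wirtinger_cst l 1 z)
    (has_wirtingerZ (-1) (has_wirtinger_sqr_normc l j z)).
  by congr has_wirtinger; apply/funext => x; rewrite mulN1r -rmorphN -rmorphD.
have := has_wirtingerXV n z0 w.
by congr has_wirtinger; rewrite mulNr rmorphN; ring.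
Qed.

Lemma has_wirtinger_uval_v (R : realType) m (l j : 'I_m) (z v : 'rV[R[i]]_m) :
  has_wirtinger l (fun u => (uval z u j)%:C) v
    ((j == l)%:R * (((1 - Normc.normc (z 0 j) ^+ 2) ^- 2)%:C * (v 0 j)^*%C))
    ((j == l)%:R * (((1 - Normc.normc (z 0 j) ^+ 2) ^- 2)%:C * v 0 j)).
Proof.
have := has_wirtingerZ ((1 - Normc.normc (z 0 j) ^+ 2) ^- 2)%:C
  (has_wirtinger_sqr_normc l j v).
congr has_wirtinger; rewrite 1?mulrCA //.
by apply/funext => u; rewrite -rmorphM mulrC.
Qed.

(** The first coefficient is grouped as c_j v^j times the one in [has_wirtinger_uval_v], which is
    the relation du_j/dz^j = c_j v^j du_j/dv^j. *)
Lemma has_wirtinger_uval_z (R : realType) m (l j : 'I_m) (z v : 'rV[R[i]]_m) :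
  polydisc z ->
  has_wirtinger l (fun x => (uval x v j)%:C) z
    ((j == l)%:R * (2%:R * ((1 - Normc.normc (z 0 j) ^+ 2)^-1)%:C * (z 0 j)^*%C
      * v 0 j * (((1 - Normc.normc (z 0 j) ^+ 2) ^- 2)%:C * (v 0 j)^*%C)))
    ((j == l)%:R * (2%:R * ((1 - Normc.normc (z 0 j) ^+ 2)^-1)%:C * z 0 j
      * v 0 j * (((1 - Normc.normc (z 0 j) ^+ 2) ^- 2)%:C * (v 0 j)^*%C))).
Proof.
move=> Dz; have := has_wirtingerZ (Normc.normc (v 0 j) ^+ 2)%:C
  (has_wirtinger_subr_sqr_normcXV l j 2 Dz).
rewrite sqr_normcM -exprVn (exprS _ 2) exprVn !rmorphM rmorph_nat.
congr has_wirtinger; [|ring|ring].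
by apply/funext => x; rewrite -sqr_normcM -rmorphM.
Qed.

(* dG/du_j. *)
Definition phi (R : realType) m (t : R) k (u : 'I_m -> R) (j : 'I_m) : R :=
  (1 + t)^-1 * (1 + t * ((\sum_l u l ^+ k) `^ (k%:R^-1 - 1) * u j ^+ k.-1)).

(* d^2G/du_i du_j. *)
Definition psi (R : realType) m (t : R) k (u : 'I_m -> R) (i j : 'I_m) : R :=
  (1 + t)^-1 * t *
  ((k%:R^-1 - 1) * (\sum_l u l ^+ k) `^ (k%:R^-1 - 1 - 1)
     * (k%:R * u i ^+ k.-1) * u j ^+ k.-1 +
   (i == j)%:R * ((\sum_l u l ^+ k) `^ (k%:R^-1 - 1)
     * (k.-1%:R * u j ^+ k.-2))).

(** Used with p = 1/k for G and with p = 1/k - 1 for its gradient [phi]. *)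
Lemma has_wirtinger_sumXpowR (R : realType) m (l : 'I_m) k (p : R)
    (u : 'rV[R[i]]_m -> 'I_m -> R) (z : 'rV[R[i]]_m) (a b : 'I_m -> R[i]) :
  0 < \sum_j u z j ^+ k ->
  (forall j, has_wirtinger l (fun x => (u x j)%:C) z (a j) (b j)) ->
  has_wirtinger l (fun x => ((\sum_j u x j ^+ k) `^ p)%:C) z
    ((p * (\sum_j u z j ^+ k) `^ (p - 1))%:C *
       \sum_i k%:R * (u z i)%:C ^+ k.-1 * a i)
    ((p * (\sum_j u z j ^+ k) `^ (p - 1))%:C *
       \sum_i k%:R * (u z i)%:C ^+ k.-1 * b i).
Proof.
move=> S0 w; apply: (@has_wirtinger_powR _ _ _ _ (fun x => \sum_j u x j ^+ k)) => //.
have := has_wirtinger_sum (fun i => has_wirtingerX k (w i)).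
congr has_wirtinger; apply/funext => x; rewrite rmorph_sum.
by apply: eq_bigr => i _; rewrite rmorphXn.
Qed.

Lemma has_wirtinger_Gtk (R : realType) m (l : 'I_m) (t : R) k
    (u : 'rV[R[i]]_m -> 'I_m -> R) (z : 'rV[R[i]]_m) (a b : 'I_m -> R[i]) :
  (0 < k)%N -> 0 < \sum_j u z j ^+ k ->
  (forall j, has_wirtinger l (fun x => (u x j)%:C) z (a j) (b j)) ->
  has_wirtinger l (fun x => (Gtk t k (u x))%:C) z
    (\sum_j (phi t k (u z) j)%:C * a j) (\sum_j (phi t k (u z) j)%:C * b j).
Proof.
move=> k0 S0 w; have wS := has_wirtinger_sumXpowR k%:R^-1 S0 w.
have := has_wirtingerZ ((1 + t)^-1)%:C (has_wirtingerD (has_wirtinger_sum w)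
  (has_wirtingerZ t%:C wS)).
(* The exponent 1/k of the root cancels the factor k from differentiating u^k. *)
have kC : (k%:R^-1)%:C * k%:R = 1 :> R[i].
  by rewrite -(rmorph_nat (real_complex R)) -rmorphM mulVf // pnatr_eq0 gtn_eqF.
have E (c : 'I_m -> R[i]) : ((1 + t)^-1)%:C * (\sum_i c i + t%:C *
    ((k%:R^-1 * (\sum_j u z j ^+ k) `^ (k%:R^-1 - 1))%:C *
     (\sum_i k%:R * (u z i)%:C ^+ k.-1 * c i))) =
    \sum_j (phi t k (u z) j)%:C * c j.
  rewrite !mulr_sumr -big_split mulr_sumr; apply: eq_bigr => i _ /=.
  rewrite /phi !(rmorphM, rmorphD, rmorphXn, rmorph1) /=.
  transitivity (((1 + t)^-1)%:C * (c i + t%:C * (((k%:R^-1)%:C * k%:R) *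
    ((\sum_j u z j ^+ k) `^ (k%:R^-1 - 1))%:C * (u z i)%:C ^+ k.-1 * c i))).
    by ring.
  by rewrite kC; ring.
rewrite !E; congr has_wirtinger; apply/funext => x.
by rewrite /Gtk !(rmorphM, rmorphD) /= rmorph_sum.
Qed.

Lemma has_wirtinger_phi (R : realType) m (l : 'I_m) (t : R) k (j : 'I_m)
    (u : 'rV[R[i]]_m -> 'I_m -> R) (z : 'rV[R[i]]_m) (a b : 'I_m -> R[i]) :
  0 < \sum_j u z j ^+ k ->
  (forall j, has_wirtinger l (fun x => (u x j)%:C) z (a j) (b j)) ->
  has_wirtinger l (fun x => (phi t k (u x) j)%:C) z
    (\sum_i (psi t k (u z) i j)%:C * a i) (\sum_i (psi t k (u z) i j)%:C * b i).
Proof.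
move=> S0 w; have wS := has_wirtinger_sumXpowR (k%:R^-1 - 1) S0 w.
have := has_wirtingerZ ((1 + t)^-1)%:C (has_wirtingerD (has_wirtinger_cst l 1 z)
  (has_wirtingerZ t%:C (has_wirtingerM wS (has_wirtingerX k.-1 (w j))))).
have E (c : 'I_m -> R[i]) : ((1 + t)^-1)%:C * (0 + t%:C *
    (((\sum_j u z j ^+ k) `^ (k%:R^-1 - 1))%:C *
     (k.-1%:R * (u z j)%:C ^+ k.-2 * c j) +
     (u z j)%:C ^+ k.-1 *
     (((k%:R^-1 - 1) * (\sum_j u z j ^+ k) `^ (k%:R^-1 - 1 - 1))%:C *
     (\sum_i k%:R * (u z i)%:C ^+ k.-1 * c i)))) =
    \sum_i (psi t k (u z) i j)%:C * c i.
  (* Differentiating u_j^(k-1) gives a single term, at i = j; it is split off here and then absorbed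
     into the sum as the diagonal part of [psi]. *)
  transitivity (\sum_i (((1 + t)^-1 * t * ((k%:R^-1 - 1) *
     (\sum_l u z l ^+ k) `^ (k%:R^-1 - 1 - 1)
     * (k%:R * u z i ^+ k.-1) * u z j ^+ k.-1))%:C * c i) +
     ((1 + t)^-1 * t * ((\sum_l u z l ^+ k) `^ (k%:R^-1 - 1)
     * (k.-1%:R * u z j ^+ k.-2)))%:C * c j).
    rewrite add0r mulrDr mulrDr addrC; congr (_ + _).
      rewrite !mulr_sumr; apply: eq_bigr => i _.
      by rewrite !(rmorphM, rmorphXn, rmorph_nat) /=; ring.
    by rewrite !(rmorphM, rmorphXn, rmorph_nat) /=; ring.
  rewrite [in RHS](eq_bigr (fun i => ((1 + t)^-1 * t * ((k%:R^-1 - 1) *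
     (\sum_l u z l ^+ k) `^ (k%:R^-1 - 1 - 1)
     * (k%:R * u z i ^+ k.-1) * u z j ^+ k.-1))%:C * c i +
     ((1 + t)^-1 * t * ((i == j)%:R * ((\sum_l u z l ^+ k) `^ (k%:R^-1 - 1)
     * (k.-1%:R * u z j ^+ k.-2))))%:C * c i)); last first.
    by move=> i _; rewrite /psi mulrDr rmorphD mulrDl.
  rewrite big_split /= [in X in _ = _ + X](bigD1 j) //= eqxx mul1r.
  rewrite [X in _ = _ + (_ + X)]big1 ?addr0 // => i /negbTE ->.
  by rewrite mul0r mulr0 rmorph0 mul0r.
rewrite !E; congr has_wirtinger; apply/funext => x.
by rewrite /phi !(rmorphM, rmorphD, rmorphXn, rmorph1).
Qed.

Lemma sum_delta (R : realType) m (l : 'I_m) (f g : 'I_m -> R[i]) :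
  \sum_j f j * ((j == l)%:R * g j) = f l * g l.
Proof.
rewrite (bigD1 l) //= eqxx mul1r big1 ?addr0 // => j /negbTE ->.
by rewrite mul0r mulr0.
Qed.

(* Diagonal entry of the Bergman metric. *)
Definition wt (R : realType) m (z : 'rV[R[i]]_m) (j : 'I_m) : R :=
  (1 - Normc.normc (z 0 j) ^+ 2) ^- 2.

(* The function c_j of the header. *)
Definition christoffel (R : realType) m (z : 'rV[R[i]]_m) (j : 'I_m) : R[i] :=
  2%:R * ((1 - Normc.normc (z 0 j) ^+ 2)^-1)%:C * (z 0 j)^*%C.

(** The product rule for d/dv^i applied to phi_j wt_j v^j: the first term differentiates v^j, the
    second phi_j. *)
Definition levi_coef (R : realType) m (t : R) k (z v : 'rV[R[i]]_m)
    (i j : 'I_m) : R[i] :=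
  (phi t k (uval z v) j)%:C * ((j == i)%:R * (wt z j)%:C) +
  (wt z j)%:C * v 0 j *
    ((psi t k (uval z v) i j)%:C * ((wt z i)%:C * (v 0 i)^*%C)).

Lemma dzbar_Gsq (R : realType) m (j : 'I_m) (t : R) k (z v : 'rV[R[i]]_m) :
  (0 < k)%N -> 0 <= t -> polydisc z -> v != 0 ->
  dzbar j (Gsq (Ftk t k) z) v =
  (phi t k (uval z v) j)%:C * ((wt z j)%:C * v 0 j).
Proof.
move=> k0 t0 Dz v0.
have := has_wirtinger_Gtk t k0 (sum_uvalX_gt0 k Dz v0)
  (fun i => has_wirtinger_uval_v j i z v).
rewrite (_ : (fun u => _) = Gsq (Ftk t k) z); last first.
  by apply/funext => u; rewrite /Gsq Ftk_sqr.
by move/has_wirtinger_dzbar ->; rewrite sum_delta.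
Qed.

Lemma dz_Gsq (R : realType) m (l : 'I_m) (t : R) k (z v : 'rV[R[i]]_m) :
  (0 < k)%N -> 0 <= t -> polydisc z -> v != 0 ->
  dz l (fun x => Gsq (Ftk t k) x v) z =
  (phi t k (uval z v) l)%:C *
    (christoffel z l * v 0 l * ((wt z l)%:C * (v 0 l)^*%C)).
Proof.
move=> k0 t0 Dz v0.
have := has_wirtinger_Gtk (u := fun x => uval x v) t k0 (sum_uvalX_gt0 k Dz v0)
  (fun i => has_wirtinger_uval_z l i v Dz).
rewrite (_ : (fun x => _) = (fun x => Gsq (Ftk t k) x v)); last first.
  by apply/funext => x; rewrite /Gsq Ftk_sqr.
by move/has_wirtinger_dz ->; rewrite sum_delta.
Qed.

Lemma levi_mxE (R : realType) m (i j : 'I_m) (t : R) k (z v : 'rV[R[i]]_m) :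
  (0 < k)%N -> 0 <= t -> polydisc z -> v != 0 ->
  levi_mx (Ftk t k) z v i j = levi_coef t k z v i j.
Proof.
move=> k0 t0 Dz v0; rewrite mxE.
have w1 := has_wirtinger_phi t j (sum_uvalX_gt0 k Dz v0)
  (fun n => has_wirtinger_uval_v i n z v).
have w2 := has_wirtingerZ (wt z j)%:C (has_wirtinger_coord i j v).
(* The formula for the inner derivative holds off v = 0, which small displacements along a line
   preserve. *)
have nr : near_lines i v (fun x => (phi t k (uval z x) j)%:C *
    ((wt z j)%:C * x 0 j) = dzbar j (Gsq (Ftk t k) z) x).
  move=> d; apply: filterS (near_lines_neq0 i v0 d) => s vs.
  by rewrite dzbar_Gsq.
rewrite (has_wirtinger_dz (near_eq_has_wirtinger nr (has_wirtingerM w1 w2))).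
by rewrite sum_delta /levi_coef [(j == i)%:R * _]mulrC.
Qed.

(** Reconciles the index order when d/dconj(v^s) is applied to phi_l, which yields [psi] at (s, l),
    with the Levi entry at (l, s). *)
Lemma psiC (R : realType) m (t : R) k (u : 'I_m -> R) (i j : 'I_m) :
  psi t k u i j = psi t k u j i.
Proof.
by rewrite /psi [j == i]eq_sym; case: eqP => [->//|_]; rewrite !mul0r !addr0; ring.
Qed.

(** The factor c_l v^l is holomorphic in v, so d/dconj(v^s) acts only on the remaining factor phi_l
    wt_l conj(v^l), which is dF^2/dv^l. *)
Lemma dzbar_dz_Gsq (R : realType) m (s l : 'I_m) (t : R) k (z v : 'rV[R[i]]_m) :
  (0 < k)%N -> 0 <= t -> polydisc z -> v != 0 ->
  dzbar s (fun u => dz l (fun x => Gsq (Ftk t k) x u) z) v =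
  christoffel z l * v 0 l * levi_mx (Ftk t k) z v l s.
Proof.
move=> k0 t0 Dz v0; rewrite levi_mxE //.
have w1 := has_wirtinger_phi t l (sum_uvalX_gt0 k Dz v0)
  (fun n => has_wirtinger_uval_v s n z v).
have w2 := has_wirtinger_coord s l v.
have w3 := has_wirtingerM (has_wirtingerZ (christoffel z l) w2)
  (has_wirtingerZ (wt z l)%:C (has_wirtinger_conj w2)).
have nr : near_lines s v (fun u => (phi t k (uval z u) l)%:C *
    (christoffel z l * u 0 l * ((wt z l)%:C * (u 0 l)^*%C)) =
    dz l (fun x => Gsq (Ftk t k) x u) z).
  move=> d; apply: filterS (near_lines_neq0 s v0 d) => r vr.
  by rewrite dz_Gsq.
rewrite (has_wirtinger_dzbar (near_eq_has_wirtinger nr (has_wirtingerM w1 w3))).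
rewrite !sum_delta /levi_coef conjc_nat psiC [s == l]eq_sym.
by case: eqP => [->|_]; rewrite /wt ?[false%:R]/(0 : R[i]); ring.
Qed.

(** * Positivity and invertibility of the Levi matrix *)

(** The form at w pairs the row w A with conj(w), so it would vanish at a nonzero left kernel
    vector. *)
Lemma posdef_unitmx (R : realType) m (A : 'M[R[i]]_m) : posdef A -> A \in unitmx.
Proof.
move=> pA; rewrite -row_free_unit -kermx_eq0.
apply/negPn/negP => /rowV0Pn[w /sub_kermxP wA w0].
have := pA w w0; rewrite exchange_big /= big1 ?ltxx // => j _.
have wAj : \sum_i A i j * w 0 i = 0.
  transitivity ((w *m A) 0 j); last by rewrite wA mxE.
  by rewrite mxE; apply: eq_bigr => i _; rewrite mulrC.
by rewrite -mulr_suml wAj mul0r.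
Qed.

(* The Levi matrix is a positive diagonal plus a nonpositive rank-one term,
   which the Cauchy-Schwarz inequality absorbs into the diagonal. *)
Lemma pseudoconvex_Ftk (R : realType) m k (t : R) : (1 < k)%N -> 0 <= t ->
  strongly_pseudoconvex (@polydisc R m) (Ftk t k).
Proof.
move=> k1 t0 z v Dz v0 w w0; have k0 := ltnW k1.
set u := uval z v; have u0 l : 0 <= u l := uval_ge0 z v l.
set S := \sum_l u l ^+ k; have S0 : 0 < S := sum_uvalX_gt0 k Dz v0.
(* The other power of S in [phi] and [psi] is T S, so the identities below become polynomial in T
   and S. *)
pose T := S `^ (k%:R^-1 - 1 - 1); have T0 : 0 < T by exact: powR_gt0.
have TS : S `^ (k%:R^-1 - 1) = T * S.
  by rewrite /T -[X in _ * X](powRr1 (ltW S0)) -powRD ?subrK // (gt_eqF S0) implybT.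
have q0 l : 0 < wt z l by rewrite invr_gt0 exprn_gt0 ?polydisc_subr_gt0.
have uE l : u l = wt z l * Normc.normc (v 0 l) ^+ 2 by rewrite mulrC.
(* These weights are chosen so that p_l |v^l|^2 = u_l^k, whose sum is S. *)
pose p l := u l ^+ k.-1 * wt z l.
have p0 l : 0 <= p l by rewrite mulr_ge0 ?exprn_ge0 // ltW.
have c0 : 0 < (1 + t)^-1 by rewrite invr_gt0 ltr_wpDr.
pose nw l := Normc.normc (w 0 l) ^+ 2.
pose X := \sum_l (p l)%:C * (v 0 l)^*%C * w 0 l.
have pv l : p l * Normc.normc (v 0 l) ^+ 2 = u l ^+ k.
  by rewrite /p -mulrA -uE -exprSr prednK.
have normcJ' (x : R[i]) : Normc.normc x^*%C = Normc.normc x.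
  by case: x => a b /=; rewrite sqrrN.
have CS : Normc.normc X ^+ 2 <= S * \sum_l p l * nw l.
  apply: le_trans (normc_cauchy_schwarz _ _ p0) _.
  rewrite /S; under eq_bigr do rewrite normcJ' pv.
  by [].
have k0R : (k%:R : R) != 0 by rewrite pnatr_eq0 gtn_eqF.
(* Up to the factor 1/(1 + t), [phi] contributes wt + t T S p to the diagonal and the diagonal part
   of [psi] a further (k - 1) t T S p. In [e], the factor 1 - k is k (1/k - 1). *)
pose D l := (1 + t)^-1 * (wt z l + t * T * S * k%:R * p l).
pose e := (1 + t)^-1 * t * (1 - k%:R) * T.
have XJ j : ((p j)%:C * (v 0 j)^*%C * w 0 j)^*%C =
    (p j)%:C * v 0 j * (w 0 j)^*%C.
  case: (v 0 j) (w 0 j) => a b [c d]; apply/eqP; rewrite eq_complex /=.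
  by apply/andP; split; apply/eqP; ring.
have CD (x y : R) : (x + y)%:C = x%:C + y%:C by exact: rmorphD.
have CM (x y : R) : (x * y)%:C = x%:C * y%:C by exact: rmorphM.
have coefE i j : levi_mx (Ftk t k) z v i j * w 0 i * (w 0 j)^*%C =
    (j == i)%:R * ((D i)%:C * w 0 i * (w 0 i)^*%C) +
    e%:C * (((p i)%:C * (v 0 i)^*%C * w 0 i) *
            ((p j)%:C * (v 0 j)^*%C * w 0 j)^*%C).
  rewrite levi_mxE // /levi_coef -/u.
  rewrite XJ.
  have psiE : psi t k u i j = (1 + t)^-1 * t * ((1 - k%:R) * T * u i ^+ k.-1 *
     u j ^+ k.-1 + (i == j)%:R * (T * S * (k.-1%:R * u j ^+ k.-2))).
    rewrite /psi -/S TS -/T; congr (_ * (_ + _)).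
    by rewrite -[in RHS](mulVf k0R); field.
  have eE : e%:C * ((p i)%:C * (p j)%:C) = ((1 + t)^-1 * t * ((1 - k%:R) * T *
      u i ^+ k.-1 * u j ^+ k.-1))%:C * (wt z i)%:C * (wt z j)%:C.
    by rewrite -!rmorphM /e /p /=; congr (_%:C); ring.
  transitivity ((phi t k u j)%:C * ((j == i)%:R * (wt z j)%:C) * w 0 i * (w 0 j)^*%C
    + (i == j)%:R * ((1 + t)^-1 * t * (T * S * (k.-1%:R * u j ^+ k.-2)))%:C *
      ((wt z j)%:C * v 0 j * (wt z i)%:C * (v 0 i)^*%C * w 0 i * (w 0 j)^*%C)
    + e%:C * ((p i)%:C * (p j)%:C) * (v 0 i)^*%C * w 0 i * v 0 j * (w 0 j)^*%C);
    last first.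
    congr (_ + _); last by ring.
    rewrite [i == j]eq_sym; case: (j =P i) => [->|_]; last by rewrite !mul0r mulr0 !mul0r addr0.
    rewrite !mul1r; transitivity ((phi t k u i * wt z i + (1 + t)^-1 * t *
       (T * S * (k.-1%:R * u i ^+ k.-2)) * wt z i * u i)%:C * (w 0 i * (w 0 i)^*%C)).
      have uC : (u i)%:C = (wt z i)%:C * (v 0 i * (v 0 i)^*%C).
        by rewrite -sqr_normcM -rmorphM -uE.
      by rewrite CD [(_ * u i)%:C]CM uC !CM; ring.
    rewrite mulrA; congr (_%:C * _ * _).
    (* Writing k = n + 2 makes u^(k-2) u = u^(k-1) free of truncated predecessors. *)
    rewrite /phi -/S TS /D /p; case: (k) k1 => [|[|n]] // _ /=.
    by rewrite (exprS _ n) -!natr1; ring.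
  rewrite eE psiE !(rmorphD, rmorphM, rmorph_nat) /=; ring.
have -> : \sum_i \sum_j levi_mx (Ftk t k) z v i j * w 0 i * (w 0 j)^*%C =
    (\sum_i D i * nw i + e * Normc.normc X ^+ 2)%:C.
  under eq_bigr do under eq_bigr do rewrite coefE.
  under eq_bigr do rewrite big_split /=.
  rewrite big_split /= CD rmorph_sum; congr (_ + _).
    apply: eq_bigr => i _; rewrite (bigD1 i) //= eqxx mul1r big1 ?addr0.
      by rewrite -mulrA -sqr_normcM -rmorphM.
    by move=> j /negbTE ->; rewrite mul0r.
  rewrite [(e * _)%:C]CM sqr_normcM /X (rmorph_sum conjc) mulr_suml mulr_sumr.
  by apply: eq_bigr => i _; rewrite -mulr_sumr -mulr_sumr.
rewrite ltcR.
(* Multiplication by e <= 0 reverses the Cauchy-Schwarz bound. *)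
have eX : (1 + t)^-1 * t * (1 - k%:R) * T * (S * \sum_l p l * nw l) <=
    e * Normc.normc X ^+ 2.
  apply: ler_wnM2l CS; apply: mulr_le0_ge0 (ltW T0).
  by apply: mulr_ge0_le0; rewrite ?mulr_ge0 ?(ltW c0) // subr_le0 ler1n.
apply: lt_le_trans (lerD (lexx _) eX).
(* The factor k from [D] and 1 - k from [e] add up to 1. *)
have -> : \sum_i D i * nw i + (1 + t)^-1 * t * (1 - k%:R) * T * (S * \sum_l p l * nw l)
    = (1 + t)^-1 * (\sum_i wt z i * nw i + t * T * S * \sum_l p l * nw l).
  have -> : \sum_i D i * nw i = (1 + t)^-1 * (\sum_i wt z i * nw i +
      t * T * S * k%:R * \sum_l p l * nw l).
    rewrite mulr_sumr -big_split mulr_sumr; apply: eq_bigr => i _.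
    by rewrite /D /=; ring.
  by ring.
rewrite mulr_gt0 // ltr_wpDr //.
  apply: mulr_ge0; first by rewrite !mulr_ge0 // ltW.
  by apply: sumr_ge0 => i _; rewrite mulr_ge0 ?sqr_ge0.
have /row_neq0P[j wj] := w0.
have nwj : 0 < nw j by rewrite /nw sqr_normc_gt0.
rewrite (bigD1 j) //= ltr_wpDr ?(mulr_gt0 (q0 j) nwj) //.
by apply: sumr_ge0 => i _; rewrite mulr_ge0 ?sqr_ge0 // ltW.
Qed.

(** * Connection and curvature *)

Lemma nonlinear_coefE (R : realType) m (i l : 'I_m) (t : R) k (z v : 'rV[R[i]]_m) :
  (1 < k)%N -> 0 <= t -> polydisc z -> v != 0 ->
  nonlinear_coef (Ftk t k) i l z v = (l == i)%:R * (christoffel z l * v 0 l).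
Proof.
move=> k1 t0 Dz v0; rewrite /nonlinear_coef.
have uA := posdef_unitmx (pseudoconvex_Ftk k1 t0 Dz v0).
under eq_bigr => s _ do rewrite dzbar_dz_Gsq ?(ltnW k1) // mulrCA.
rewrite -mulr_sumr mulrC; congr (_ * _).
(* Row l of the Levi matrix against column i of its inverse is the Kronecker delta. *)
have := congr1 (fun B : 'M[R[i]]_m => B l i) (mulmxV uA); rewrite /= !mxE => <-.
by apply: eq_bigr => s _; rewrite mulrC.
Qed.

Lemma horizontal_coefE (R : realType) m (i j l : 'I_m) (t : R) k
    (z v : 'rV[R[i]]_m) : (1 < k)%N -> 0 <= t -> polydisc z -> v != 0 ->
  horizontal_coef (Ftk t k) i j l z v =
  (l == i)%:R * (christoffel z l * (l == j)%:R).
Proof.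
move=> k1 t0 Dz v0.
have w := has_wirtingerZ (l == i)%:R
  (has_wirtingerZ (christoffel z l) (has_wirtinger_coord j l v)).
apply: (has_wirtinger_dz (near_eq_has_wirtinger _ w)) => d.
by apply: filterS (near_lines_neq0 j v0 d) => s vs; rewrite nonlinear_coefE.
Qed.

(** With q = 1 - |z^j|^2, the product rule gives 2 (1/q + |z^j|^2 / q^2) = 2 / q^2. The curvature
    involves only the antiholomorphic derivative, so the other one is left existential. *)
Lemma has_wirtinger_christoffel (R : realType) m (l j : 'I_m) (z : 'rV[R[i]]_m) :
  polydisc z -> exists a,
  has_wirtinger l (fun x => christoffel x j) z a
    ((j == l)%:R * (2%:R * (wt z j)%:C)).
Proof.
move=> Dz; have z0 := polydisc_subr_gt0 j Dz.
have wz := has_wirtinger_subr_sqr_normcXV l j 1 Dz.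
have w := has_wirtingerM (has_wirtingerZ 2%:R wz)
  (has_wirtinger_conj (has_wirtinger_coord l j z)).
eexists; move: w; congr has_wirtinger.
have E : (((1 - Normc.normc (z 0 j) ^+ 2) ^- 1)%:C : R[i]) =
    (1 - Normc.normc (z 0 j) ^+ 2)%:C * (wt z j)%:C.
  rewrite -rmorphM /wt; congr (_%:C).
  by rewrite expr1 expr2 invfM mulrA divff ?mul1r // gt_eqF.
have E' : ((1 - Normc.normc (z 0 j) ^+ 2)%:C : R[i]) = 1 - z 0 j * (z 0 j)^*%C.
  by rewrite -sqr_normcM rmorphB.
rewrite conjc_nat E E' mul1r /wt; ring.
Qed.

(** * The Bergman metric and the Einstein condition *)

Lemma invmx_bergman (R : realType) m (z : 'rV[R[i]]_m) : polydisc z ->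
  invmx (bergman z) =
  \matrix_(a, b) ((a == b)%:R * ((1 - Normc.normc (z 0 a) ^+ 2) ^+ 2)%:C).
Proof.
move=> Dz; set B := \matrix_(_, _) _.
have BB : bergman z *m B = 1%:M.
  apply/matrixP => a b; rewrite !mxE.
  under eq_bigr do rewrite !mxE.
  have qz : (1 - Normc.normc (z 0 a) ^+ 2) ^+ 2 != 0.
    by rewrite expf_neq0 // gt_eqF // polydisc_subr_gt0.
  rewrite (bigD1 a) //= eqxx mul1r big1 ?addr0; last first.
    by move=> c /negbTE ca; rewrite [a == c]eq_sym ca !mul0r.
  by rewrite mulrCA -rmorphM mulVf //= mulr1.
have [uB _] := mulmx1_unit BB.
by rewrite -[RHS](mulKmx uB) BB mulmx1.
Qed.

Lemma bergmanE (R : realType) m (a b : 'I_m) (z : 'rV[R[i]]_m) :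
  bergman z a b = (a == b)%:R * (wt z a)%:C.
Proof. by rewrite mxE. Qed.

Lemma posdef_bergman (R : realType) m (z : 'rV[R[i]]_m) :
  polydisc z -> posdef (bergman z).
Proof.
move=> Dz w w0.
have -> : \sum_i \sum_j bergman z i j * w 0 i * (w 0 j)^*%C =
    (\sum_i wt z i * Normc.normc (w 0 i) ^+ 2)%:C.
  rewrite rmorph_sum; apply: eq_bigr => i _.
  rewrite (bigD1 i) //= bergmanE eqxx mul1r big1 ?addr0.
    by rewrite -mulrA -sqr_normcM -rmorphM.
  by move=> j ji; rewrite bergmanE eq_sym (negbTE ji) !mul0r.
have wt0 i : 0 < wt z i by rewrite invr_gt0 exprn_gt0 ?polydisc_subr_gt0.
rewrite ltcR; have /row_neq0P[j] := w0; rewrite -sqr_normc_gt0 => wj.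
rewrite (bigD1 j) //= ltr_wpDr ?(mulr_gt0 (wt0 j) wj) //.
by apply: sumr_ge0 => i _; rewrite mulr_ge0 ?sqr_ge0 // ltW.
Qed.

Lemma smooth_bergman (R : realType) m (a b : 'I_m) :
  smooth_base (@polydisc R m) (fun z => bergman z a b).
Proof.
have oU := @open_polydisc R m; set U := _ @^-1` _ in oU.
split=> n; last first.
  rewrite (_ : (fun p => _) = fun=> 0); first exact: Cn_cst.
  apply/funext => p; rewrite bergmanE.
  by case: eqP => _; rewrite ?mul1r ?mul0r.
rewrite (_ : (fun p => _) = fun p => (a == b)%:R * wt (ofreal p) a); last first.
  apply/funext => p; rewrite bergmanE.
  by case: eqP => _; rewrite ?mul1r ?mul0r.
apply: CnM (Cn_cst n U _) _ => //.
have U0 p (Up : U p) := polydisc_subr_gt0 a Up.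
apply: CnV => // [p Up|]; first exact: exprn_gt0 (U0 p Up).
apply: CnX => //.
have Cz : Cn n U (fun p => Normc.normc (ofreal p 0 a) ^+ 2).
  by apply: (@Cn_sqr_normc R m _ n U id a oU) => // p; exact: cvg_id.
apply: (eq_Cn oU _ (CnD oU (Cn_cst n U 1) (CnM oU (Cn_cst n U (-1)) Cz))).
by move=> p _; rewrite mulN1r.
Qed.

(** With q = 1 - |z^i|^2, the factor q^2 of the inverse turns the derivative 2 q^(-3) conj(z^i) of
    the weight into 2 q^(-1) conj(z^i) = c_i. *)
Lemma chern_coef_bergman (R : realType) m (i j l : 'I_m) (z : 'rV[R[i]]_m) :
  polydisc z ->
  chern_coef (@bergman R m) i j l z = (l == i)%:R * (christoffel z l * (l == j)%:R).
Proof.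
move=> Dz; rewrite /chern_coef invmx_bergman //.
rewrite (bigD1 i) //= mxE eqxx mul1r big1 ?addr0; last first.
  by move=> s /negbTE si; rewrite mxE si !mul0r.
have w := has_wirtingerZ (j == i)%:R (has_wirtinger_subr_sqr_normcXV l j 2 Dz).
rewrite (_ : (fun x => bergman x j i) =
  (fun x => (j == i)%:R * ((1 - Normc.normc (x 0 j) ^+ 2) ^- 2)%:C)); last first.
  by apply/funext => x; rewrite bergmanE.
rewrite (has_wirtinger_dz w) [l == j]eq_sym.
case: (j =P i) => [->|ji]; last first.
  rewrite mul0r mulr0; case: (j =P l) => [<-|_]; last by rewrite !mulr0.
  by case: (j =P i) => // _; rewrite mul0r.
rewrite [l == i]eq_sym; case: (i =P l) => [<-|_]; last by rewrite !mul0r !mulr0.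
have z0 := polydisc_subr_gt0 i Dz.
rewrite !mul1r mulr1 /christoffel mulrA -rmorphM; congr (_ * _).
rewrite -(rmorph_nat (real_complex R)) -rmorphM; congr (_%:C).
by field; rewrite gt_eqF.
Qed.

Lemma curvature_Ftk (R : realType) m (i j a b : 'I_m) (t : R) k
    (z v : 'rV[R[i]]_m) : (1 < k)%N -> 0 <= t -> polydisc z -> v != 0 ->
  curvature (Ftk t k) i j a b z v =
  - ((a == i)%:R * (a == j)%:R * ((a == b)%:R * (2%:R * (wt z a)%:C))).
Proof.
move=> k1 t0 Dz v0; rewrite /curvature; congr (- _).
have [c w] := has_wirtinger_christoffel b a Dz.
apply: (has_wirtinger_dzbar (near_eq_has_wirtinger _
  (has_wirtingerZ ((a == i)%:R * (a == j)%:R) w))) => d.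
(* The differentiation is now in z, so the formula is needed at nearby base points. *)
apply: filterS (near_lines_polydisc b Dz d) => s Ds.
by rewrite horizontal_coefE // mulrA mulrAC.
Qed.

Theorem theorem1p4 (R : realType) (m k : nat) (t : R)
    (hm : (2 <= m)%N) (hk : (2 <= k)%N) (ht : (0 <= t)%R) :
  kahler_finsler_einstein (@polydisc R m) (@Ftk R m t k) (@bergman R m)
    (- 2)%R.
Proof.
split.
- split.
  + exact: complex_finsler_Ftk (ltnW hk) ht.
  + exact: pseudoconvex_Ftk.
  + move=> i j l z v Dz v0; rewrite !horizontal_coefE //.
    rewrite [j == l]eq_sym; case: (l =P j) => [->//|_].
    by rewrite !mulr0.
  + by move=> i j l z v w Dz v0 w0; rewrite !horizontal_coefE.
- split; [exact: smooth_bergman|exact: posdef_bergman].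
- by move=> i j l z v Dz v0; rewrite horizontal_coefE // chern_coef_bergman.
- move=> i j z v Dz v0; rewrite /mean_curvature invmx_bergman //.
  have z0 := polydisc_subr_gt0 i Dz.
  under eq_bigr do under eq_bigr do rewrite mxE curvature_Ftk //.
  (* The curvature forces a = i and the diagonal inverse metric b = a; what remains is q^2 (-2
     q^(-2)) times the Kronecker delta, with q = 1 - |z^i|^2. *)
  rewrite (bigD1 i) //= [X in _ + X]big1 ?addr0; last first.
    by move=> a /negbTE ai; apply: big1 => b _; rewrite ai !mul0r oppr0 mulr0.
  rewrite (bigD1 i) //= [X in _ + X]big1 ?addr0; last first.
    by move=> b /negbTE bi; rewrite bi !mul0r.
  rewrite eqxx !mul1r mulrN mulrCA mulrC rmorphN mulNr; congr (- (_ * _)).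
  rewrite mulrCA -rmorphM /wt mulfV ?expf_neq0 ?gt_eqF // mulr1.
  by rewrite rmorph_nat.
Qed.
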